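(* Let $\mathcal X$ be a collection of uniformly thick metric spaces (that is, uniformly thick of order at most $n$ for some $n$), and let $Y$ be a geodesic metric space which is asymptotically tree-graded with respect to a collection $\mathcal P$ of subsets. Then for every $L\ge1$ and $C\ge0$ there is a constant $M=M(L,C,\mathcal X,Y,\mathcal P)$ such that for any $X\in\mathcal X$ and any $(L,C)$-quasi-isometric embedding $\mathfrak q\colon X\to Y$, the image $\mathfrak q(X)$ is contained in the $M$-neighborhood $\mathcal N_M(P)$ of some $P\in\mathcal P$.
   Context: Asymptotic cones. For a non-principal ultrafilter $\omega$ on $\mathbb N$, points $x=(x_n)$ of a metric space $X$, and positive numbers $d=(d_n)$ with $\lim_\omega d_n=+\infty$, $\mathrm{Cone}_\omega(X,x,d)$ is the $\omega$-ultralimit of $(X,x_n,\frac1{d_n}\mathrm{dist}_X)$. For non-empty $A_n\subset X$, $\lim_\omega A_n$ is the set of points of the cone represented by sequences $(a_n)$, $a_n\in A_n$; $\lim_\omega(\mathcal A)$ is the collection of non-empty limit sets $\lim_\omega A_n$, $A_n\in\mathcal A$. Cut-points are global; a singleton is considered to have a cut-point. Tree-graded. A complete geodesic metric space is tree-graded with respect to a collection of closed geodesic subsets (pieces) if distinct pieces meet in at most one point and every simple non-trivial geodesic triangle is contained in one piece. A geodesic metric space $Y$ is asymptotically tree-graded with respect to a collection $\mathcal P$ of subsets if every asymptotic cone of $Y$ is tree-graded with respect to $\lim_\omega(\mathcal P)$ and $Y$ is not contained in a finite radius neighborhood of any $P\in\mathcal P$. Uniformly unconstricted. A collection $\mathcal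 B$ of metric spaces is uniformly unconstricted if (1) for some $c$, every point of every $B\in\mathcal B$ is at distance at most $c$ from a bi-infinite geodesic in $B$; (2) for every sequence $(B_i,\mathrm{dist}_i)$ in $\mathcal B$ there are an ultrafilter $\omega$ and scaling constants $d=(d_i)$ (with $\lim_\omega d_i=\infty$) such that for all base points $b_i\in B_i$ the ultralimit $\lim_\omega(B_i,b_i,\frac1{d_i}\mathrm{dist}_i)$ has no cut-points. This notion is understood up to uniform quasi-isometry: a collection in bijection with a uniformly unconstricted one, corresponding spaces being $(L,C)$-quasi-isometric with common $L,C$, is also uniformly unconstricted. Networks. $X$ is a $\tau$-network with respect to a collection $\mathcal L$ of subsets if (N$_1$) $X=\bigcup_{A\in\mathcal L}\mathcal N_\tau(A)$; (N$_2$) any $A,A'\in\mathcal L$ are joined by a sequence $A=A_1,\dots,A_n=A'$ in $\mathcal L$ with $\mathrm{diam}(\mathcal N_\tau(A_i)\cap\mathcal N_\tau(A_{i+1}))=\infty$ for $1\le i<n$. Here $\mathcal N_\tau$ is the $\tau$-neighborhood. Uniform thickness. A family of metric spaces is uniformly thick of order (at most) zero if it is uniformly unconstricted. A metric space $X$ is $\tau$-thick of order at most $n+1$ with respect to $\mathcal L$ if it is a $\tau$-network with respect to $\mathcal L$ and $\mathcal L$ (with restricted metrics) is uniformly thick of order at most $n$. A family $\{X_i\}_{i\in I}$ is uniformly thick of order at most $n+1$ if for some $\tau>0$ each $X_i$ is $\tau$-thick of order at most $n+1$ with respect to some collection $\mathcal L_i$ of its subsets, and $\bigcup_{i\in I}\mathcal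 L_i$ (with induced metrics) is uniformly thick of order at most $n$. *)

(* Defs.v *)
From HB Require Import structures.
From mathcomp Require Import all_boot all_order all_algebra.
From mathcomp Require Import generic_quotient.
From mathcomp Require Import all_classical all_reals all_analysis.

Set Implicit Arguments.
Unset Strict Implicit.
Unset Printing Implicit Defensive.

Import Order.TTheory GRing.Theory Num.Theory.
Import numFieldNormedType.Exports.

Local Open Scope classical_set_scope.
Local Open Scope ring_scope.

(* [set_type A] carries the topology and the balls induced by [X]; we add the
   restricted distance, so that any [A : set X] coerces to a [metricType]. *)
Section induced_metric.
Context {R : realType} {X : metricType R} (A : set X).

Definition induced_mdist (a b : A) : R := mdist (set_val a) (set_val b).

Fact induced_mdist_ge0 a b : 0 <= induced_mdist a b.
Proof. exact: mdist_ge0. Qed.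

Fact induced_mdist_positivity a b : induced_mdist a b = 0 -> a = b.
Proof. by move/mdist_positivity/val_inj. Qed.

Fact induced_ballE (a : A) (r : R) :
  ball a r = [set b | induced_mdist a b < r].
Proof.
apply/seteqP; split => b.
  by rewrite /ball/= /initial_ball ballEmdist.
by rewrite /= => ab; rewrite /ball/= /initial_ball ballEmdist.
Qed.

HB.instance Definition _ := PseudoMetric_isMetric.Build R A
  induced_mdist_ge0 induced_mdist_positivity induced_ballE.

End induced_metric.

Section metric_notions.
Context {R : realType}.
Implicit Types X Y : metricType R.

Definition tnbhd X (r : R) (A : set X) : set X := \bigcup_(a in A) ball a r.

Definition infinite_diameter X (A : set X) :=
  forall D : R, exists x y, [/\ A x, A y & D < mdist x y].

Definition isometric_on X (I : set R) (g : R -> X) :=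
  forall s t, I s -> I t -> mdist (g s) (g t) = `|s - t|.

Definition geodesic_set X (S : set X) :=
  forall x y, S x -> S y -> exists (l : R) (g : R -> X),
    [/\ 0 <= l, isometric_on `[0, l] g, g 0 = x, g l = y &
        g @` `[0, l] `<=` S].

Definition geodesic_space X := geodesic_set [set: X].

Definition biinfinite_geodesic X (g : R -> X) := isometric_on [set: R] g.

Definition complete_space X :=
  forall F : set_system X, ProperFilter F -> cauchy F -> exists x : X, F --> x.

Definition qi_embedding X Y (L C : R) (q : X -> Y) :=
  forall x x', L^-1 * mdist x x' - C <= mdist (q x) (q x') <=
               L * mdist x x' + C.

Definition quasi_isometry X Y (L C : R) (q : X -> Y) :=
  qi_embedding L C q /\ forall y, exists x, mdist y (q x) <= C.

(* Cut-points are global, and a singleton has one by convention. *)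
Definition has_cut_point X :=
  (exists p : X, [set: X] = [set p]) \/
  (exists p : X, ~ connected (~` [set p])).

(* A simple non-trivial geodesic triangle, parametrized as a loop of length
   [l]: the sides are the restrictions of [f] to [0, s], [s, t] and [t, l], and
   simplicity means that the loop does not visit a point twice. *)
Definition simple_geodesic_triangle X (f : R -> X) (s t l : R) :=
  [/\ [/\ 0 <= s, s <= t, t <= l & 0 < l],
      [/\ isometric_on `[0, s] f, isometric_on `[s, t] f &
          isometric_on `[t, l] f],
      f 0 = f l &
      {in `[0, l[ &, injective f}].

Definition tree_graded X (Pieces : set (set X)) :=
  [/\ complete_space X /\ geodesic_space X,
      forall P, Pieces P -> closed P /\ geodesic_set P,
      forall P Q, Pieces P -> Pieces Q -> P <> Q -> is_subset1 (P `&` Q) &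
      forall f s t l, simple_geodesic_triangle f s t l ->
        exists2 P, Pieces P & f @` `[0, l] `<=` P].

End metric_notions.

Record nonprincipal_ultrafilter := NonprincipalUltrafilter {
  ultra_sets :> set_system nat ;
  ultra_ultra : UltraFilter ultra_sets ;
  ultra_nonprincipal : forall n, ultra_sets <> principal_filter n
}.
#[global] Existing Instance ultra_ultra.

Record scaling (R : realType) (w : nonprincipal_ultrafilter) := Scaling {
  scaling_seq :> nat -> R ;
  scaling_gt0 : forall n, 0 < scaling_seq n ;
  scaling_infty : scaling_seq n @[n --> ultra_sets w] --> +oo
}.

Section ultralimit.
Context {R : realType} (w : nonprincipal_ultrafilter) (X : nat -> metricType R)
  (x : forall n, X n) (d : scaling R w).

Record bounded_seq := BoundedSeq {
  bseq_val :> forall n, X n ;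
  bseq_bounded : exists B : R,
    \forall n \near ultra_sets w, mdist (x n) (bseq_val n) / d n <= B
}.

HB.instance Definition _ := gen_eqMixin bounded_seq.
HB.instance Definition _ := gen_choiceMixin bounded_seq.

Definition scaled_dist (u v : bounded_seq) (n : nat) : R :=
  mdist (u n) (v n) / d n.

Definition ulim_dist (u v : bounded_seq) : R :=
  lim (scaled_dist u v n @[n --> ultra_sets w]).

Fact scaled_dist_cvg u v : cvg (scaled_dist u v n @[n --> ultra_sets w]).
Proof.
have [A hA] := bseq_bounded u; have [B hB] := bseq_bounded v.
pose F : set_system R := scaled_dist u v n @[n --> ultra_sets w].
have FU : UltraFilter F.
  split => [|G PG FG]; first exact: fmap_proper_filter.
  apply/seteqP; split => // S GS.
  have [//|nS] := in_ultra_setVsetC (scaled_dist u v @^-1` S) (ultra_ultra w).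
  have GnS : G (~` S) by apply: FG; rewrite /F/= /fmap/= preimage_setC.
  by have /filter_ex [? []] : G (S `&` ~` S) by exact: filterI.
have := @segment_compact R 0 (A + B); rewrite compact_ultra => /(_ F FU).
case=> [|p [_ Fp]]; last by apply/cvg_ex; exists p.
rewrite /F/= /fmap/=; near=> n.
have d0 := scaling_gt0 d n.
rewrite /= in_itv/= divr_ge0 ?mdist_ge0 ?(ltW d0)//= /scaled_dist.
have uA : mdist (x n) (u n) / d n <= A by near: n.
have vB : mdist (x n) (v n) / d n <= B by near: n.
apply: le_trans (lerD uA vB).
rewrite -mulrDl ler_pM2r ?invr_gt0// [mdist (x n) (u n)]metric_sym.
exact: metric_triangle.
Unshelve. all: by end_near. Qed.

Fact ulim_distxx u : ulim_dist u u = 0.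
Proof.
rewrite /ulim_dist (_ : scaled_dist u u = cst 0) ?lim_cst//.
by apply/funext => n; rewrite /scaled_dist mdistxx mul0r.
Qed.

Fact ulim_dist_sym u v : ulim_dist u v = ulim_dist v u.
Proof.
rewrite /ulim_dist (_ : scaled_dist u v = scaled_dist v u)//.
by apply/funext => n; rewrite /scaled_dist metric_sym.
Qed.

Fact ulim_dist_triangle v u z : ulim_dist u z <= ulim_dist u v + ulim_dist v z.
Proof.
have uv := @scaled_dist_cvg u v; have vz := @scaled_dist_cvg v z.
have <- : lim ((scaled_dist u v n + scaled_dist v z n) @[n --> ultra_sets w]) =
          ulim_dist u v + ulim_dist v z.
  by apply/cvg_lim => //; exact: cvgD.
apply: ler_lim; first exact: scaled_dist_cvg.
  exact: is_cvgD.
apply: nearW => n; rewrite /scaled_dist -mulrDl.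
by rewrite ler_pM2r ?invr_gt0 ?scaling_gt0// metric_triangle.
Qed.

Fact ulim_dist_ge0 u v : 0 <= ulim_dist u v.
Proof.
have := ulim_dist_triangle v u u.
by rewrite ulim_distxx [ulim_dist v u]ulim_dist_sym -mulr2n pmulrn_lge0.
Qed.

Definition ulim_rel (u v : bounded_seq) : bool := ulim_dist u v == 0.

Fact ulim_rel_equiv : equiv_class_of ulim_rel.
Proof.
split; first by move=> u; rewrite /ulim_rel ulim_distxx.
  by move=> u v; rewrite /ulim_rel ulim_dist_sym.
move=> v u z /eqP uv /eqP vz; rewrite /ulim_rel eq_le ulim_dist_ge0 andbT.
by rewrite (le_trans (ulim_dist_triangle v _ _))// uv vz addr0.
Qed.

Canonical ulim_equiv := EquivRelPack ulim_rel_equiv.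

Definition ultralimit : Type := {eq_quot ulim_equiv}%qT.

HB.instance Definition _ := Choice.on ultralimit.

Definition ulim_class (u : bounded_seq) : ultralimit :=
  (\pi_({eq_quot ulim_equiv}) u)%qT.

Definition ultralimit_mdist (a b : ultralimit) : R :=
  ulim_dist (repr (a : {eq_quot ulim_equiv}%qT))
            (repr (b : {eq_quot ulim_equiv}%qT)).

Fact ultralimit_mdistxx a : ultralimit_mdist a a = 0.
Proof. exact: ulim_distxx. Qed.

Fact ultralimit_mdist_positivity a b : ultralimit_mdist a b = 0 -> a = b.
Proof.
move=> ab; rewrite -[a](@reprK _ {eq_quot ulim_equiv}%qT).
by rewrite -[b](@reprK _ {eq_quot ulim_equiv}%qT); apply/eqmodP/eqP.
Qed.

Fact ultralimit_mdist_sym a b : ultralimit_mdist a b = ultralimit_mdist b a.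
Proof. exact: ulim_dist_sym. Qed.

Fact ultralimit_mdist_triangle b a c :
  ultralimit_mdist a c <= ultralimit_mdist a b + ultralimit_mdist b c.
Proof. exact: ulim_dist_triangle. Qed.

HB.instance Definition _ := isMetric.Build R ultralimit
  ultralimit_mdistxx ultralimit_mdist_positivity ultralimit_mdist_sym
  ultralimit_mdist_triangle.

Lemma mdist_ulim_class u v :
  mdist (ulim_class u) (ulim_class v) = ulim_dist u v.
Proof.
have reprd z : ulim_dist (repr (\pi_({eq_quot ulim_equiv}) z)%qT) z = 0.
  by apply/eqP/(@eqmodP _ ulim_equiv); rewrite reprK.
rewrite {1}/mdist/= /ultralimit_mdist /ulim_class.
set u' := repr _; set v' := repr _.
apply/eqP; rewrite eq_le; apply/andP; split.
  apply: le_trans (ulim_dist_triangle u _ _) _; rewrite reprd add0r.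
  apply: le_trans (ulim_dist_triangle v _ _) _.
  by rewrite [ulim_dist v v']ulim_dist_sym reprd addr0.
apply: le_trans (ulim_dist_triangle u' _ _) _.
rewrite ulim_dist_sym reprd add0r.
apply: le_trans (ulim_dist_triangle v' _ _) _.
by rewrite reprd addr0.
Qed.

Definition ulim_set (A : forall n, set (X n)) : set ultralimit :=
  [set z | exists2 a : bounded_seq, forall n, A n (a n) & z = ulim_class a].

End ultralimit.

Definition Cone (R : realType) (w : nonprincipal_ultrafilter) (Y : metricType R)
    (x : nat -> Y) (d : scaling R w) : metricType R :=
  @ultralimit R w (fun=> Y) x d.

Definition cone_pieces (R : realType) (w : nonprincipal_ultrafilter)
    (Y : metricType R) (x : nat -> Y) (d : scaling R w) (P : set (set Y)) :
    set (set (Cone x d)) :=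
  [set S | exists2 A : nat -> set Y, forall n, P (A n) &
             S = @ulim_set R w (fun=> Y) x d A /\ S !=set0].
Arguments cone_pieces {R w Y} x d P _.

Definition asymptotically_tree_graded (R : realType) (Y : metricType R)
    (P : set (set Y)) :=
  (forall (w : nonprincipal_ultrafilter) (x : nat -> Y) (d : scaling R w),
     tree_graded (cone_pieces x d P)) /\
  (forall A (r : R), P A -> ~ [set: Y] `<=` tnbhd r A).

Section thickness.
Context {R : realType}.

(* Collections of metric spaces are indexed families [B : I -> metricType R]. *)
Definition strictly_uniformly_unconstricted (I : Type) (B : I -> metricType R) :=
  (exists c : R, forall i (b : B i),
     exists2 g : R -> B i, biinfinite_geodesic g & exists t, mdist b (g t) <= c) /\
  (forall k : nat -> I, exists (w : nonprincipal_ultrafilter) (d : scaling R w),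
     forall b : forall n, B (k n),
       ~ has_cut_point (@ultralimit R w (fun n => B (k n)) b d)).

(* The notion is understood up to uniform quasi-isometry. *)
Definition uniformly_unconstricted (I : Type) (B : I -> metricType R) :=
  exists2 B' : I -> metricType R, strictly_uniformly_unconstricted B' &
    exists L C : R, [/\ 1 <= L, 0 <= C &
      forall i, exists q : B i -> B' i, quasi_isometry L C q].

Definition network (tau : R) (X : metricType R) (L : set (set X)) :=
  [set: X] = \bigcup_(A in L) tnbhd tau A /\
  (forall A A', L A -> L A' -> exists (n : nat) (S : nat -> set X),
     [/\ S 0%N = A, S n = A',
         forall i, (i <= n)%N -> L (S i) &
         forall i, (i < n)%N ->
           infinite_diameter (tnbhd tau (S i) `&` tnbhd tau (S i.+1))]).

Definition members (X : metricType R) (L : set (set X)) :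
    {A : set X | L A} -> metricType R :=
  fun p => set_type (sval p).

Definition union_members (I : Type) (X : I -> metricType R)
    (L : forall i, set (set (X i))) :
    {i : I & {A : set (X i) | L i A}} -> metricType R :=
  fun p => members (projT2 p).

Definition thick_wrt (thick : forall I : Type, (I -> metricType R) -> Prop)
    (tau : R) (X : metricType R) (L : set (set X)) :=
  network tau L /\ thick _ (@members X L).

(* Order at most [n]. *)
Fixpoint uniformly_thick (n : nat) : forall I : Type,
    (I -> metricType R) -> Prop :=
  match n with
  | 0%N => uniformly_unconstricted
  | n'.+1 => fun I X => exists2 tau : R, 0 < tau &
      exists L : forall i, set (set (X i)),
        (forall i, thick_wrt (uniformly_thick n') tau (L i)) /\
        uniformly_thick n' (@union_members I X L)
  end.

End thickness.

(* Main.v *)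
Require Import Defs.
From mathcomp Require Import all_boot all_order all_algebra ring lra.
From mathcomp Require Import all_classical all_reals all_analysis.

Set Implicit Arguments.
Unset Strict Implicit.
Unset Printing Implicit Defensive.

Import Order.TTheory GRing.Theory Num.Theory.

Local Open Scope classical_set_scope.
Local Open Scope ring_scope.

(* The key fact is that an (L, C)-quasi-line g with g([-T, T]) in the T/(8L)-neighborhood of
   some A in P has g(0) in the M-neighborhood of A, for an M independent of T and
   A: in a cone rescaled by T, a bilipschitz line close to a piece but with
   center off the piece would have to pass, on both sides of its center, through
   the projection of the center to the piece; hence T may be halved until it is bounded.

   Let B be unconstricted, q : B -> Y a quasi-isometric embedding.  A cone of B
   without cut points embeds in a cone of Y, inside one piece, so some A in P is
   close to q on a ball of radius comparable to a large scale.  Since each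
   point of B is near a quasi-line, the key fact makes q(ball) M-close to A.
   Two such A that are close along two far apart points are close on the whole
   scale, because distinct pieces of a cone share at most one point; this allows
   the radius to be doubled indefinitely.

   For higher orders, each point still lies near a quasi-line.  If neighbors S,
   S' in a network have images near A and A', then, the overlap being
   unbounded, A and A' have the same limit in the cones based at a point of
   q(S'), and the key fact puts q(S') in the M-neighborhood of A, with the same
   M at each step of a chain. *)

(** * Segments in metric spaces *)

Section metric_topology.
Context {R : realType} {T : metricType R}.

Lemma open_mdistP (U : set T) : open U <->
  forall p, U p -> exists2 e : R, 0 < e & forall q, mdist p q < e -> U q.
Proof.
rewrite openE; split=> [oU p /oU|oU p /oU [e e0 pU]].
  by move/metricType_numDomainType.nbhs_mdistP => -[e /= e0 pU]; exists e.
by apply/metricType_numDomainType.nbhs_mdistP; exists e.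
Qed.

Lemma closed_mdistP (F : set T) : closed F <->
  forall p, (forall e : R, 0 < e -> exists2 q, F q & mdist p q < e) -> F p.
Proof.
rewrite -openC open_mdistP; split=> cF p.
  move=> pF; apply: contrapT => /cF[e e0]; have [q Fq pq] := pF e e0.
  by move=> /(_ q pq).
move=> nFp; apply: contrapT => H; apply: nFp; apply: cF => e e0.
apply: contrapT => nq; apply: H; exists e => // q pq Fq; apply: nq.
by exists q.
Qed.

End metric_topology.

Section segments.
Context {R : realType} {T : metricType R}.
Implicit Types (S F M : set T) (x y z u v w p : T).

Lemma mdist_le0 x y : mdist x y <= 0 -> x = y.
Proof. by move=> xy; apply/mdist_positivity/eqP; rewrite eq_le xy mdist_ge0. Qed.

(** The image of a geodesic from [x] to [y], encoded as a set on which the distance from [x] is an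
    isometry onto the interval from 0 to [mdist x y]. Subsegments and concatenations are then
    intersections and unions, with no reparametrization. *)
Definition segment S x y :=
  [/\ S x /\ S y,
      forall u v, S u -> S v -> mdist u v = `|mdist x u - mdist x v|,
      forall u, S u -> mdist x u <= mdist x y &
      forall t, 0 <= t -> t <= mdist x y -> exists2 u, S u & mdist x u = t].

Lemma segment_endpoint S x y u : segment S x y -> S u ->
  mdist x u + mdist u y = mdist x y.
Proof.
move=> [[Sx Sy] iso le _] Su; rewrite (iso _ _ Su Sy) ler0_norm.
  by rewrite opprB addrC subrK.
by rewrite subr_le0 le.
Qed.

Lemma segment_inj S x y u v : segment S x y -> S u -> S v ->
  mdist x u = mdist x v -> u = v.
Proof.
move=> [_ iso _ _] Su Sv xuv; apply: mdist_positivity.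
by rewrite iso// xuv subrr normr0.
Qed.

Lemma segment_sym S x y : segment S x y -> segment S y x.
Proof.
move=> sS; have E := segment_endpoint sS; have [[Sx Sy] iso le ex] := sS.
have yE u : S u -> mdist y u = mdist x y - mdist x u.
  by move=> /E; rewrite (metric_sym u) => <-; rewrite addrC addKr.
split => // [u v Su Sv|u Su|t t0 tl].
- by rewrite (iso _ _ Su Sv) yE// yE// distrC; congr (`|_|); lra.
- by rewrite yE// (metric_sym y) lerBlDr lerDl mdist_ge0.
- have [||u Su xu] := ex (mdist x y - t).
  + by rewrite subr_ge0 (metric_sym x).
  + by rewrite lerBlDr lerDl.
  by exists u => //; rewrite yE// xu opprB addrC subrK.
Qed.

Lemma sub_segment S x y u v : segment S x y -> S u -> S v ->
    mdist x u <= mdist x v ->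
  segment (S `&` [set w | mdist x u <= mdist x w <= mdist x v]) u v.
Proof.
move=> sS Su Sv uv; have [[Sx Sy] iso le ex] := sS.
have uE w : S w -> mdist x u <= mdist x w -> mdist u w = mdist x w - mdist x u.
  by move=> Sw uw; rewrite iso// distrC ger0_norm// subr_ge0.
split => /=.
- by rewrite !lexx uv.
- move=> w w' [Sw /andP[uw wv]] [Sw' /andP[uw' wv']].
  by rewrite iso// uE// uE// opprB addrA subrK.
- by move=> w [Sw /andP[uw wv]]; rewrite !uE// lerD2r.
- move=> t t0; rewrite uE// => tuv.
  have [||w Sw xw] := ex (t + mdist x u).
  + by rewrite addr_ge0// mdist_ge0.
  + by apply: (@le_trans _ _ (mdist x v)); [rewrite -lerBrDr|exact: le].
  exists w; first by split=> //; rewrite xw lerDr t0 -lerBrDr.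
  by rewrite uE// xw ?addrK// lerDr.
Qed.

Lemma segment_between S x y u v : segment S x y -> S u -> S v ->
  exists2 S', segment S' u v & S' `<=` S.
Proof.
move=> sS Su Sv; have [uv|/ltW vu] := leP (mdist x u) (mdist x v).
  exists (S `&` [set w | mdist x u <= mdist x w <= mdist x v]).
    exact: (sub_segment sS).
  by move=> w [].
exists (S `&` [set w | mdist x v <= mdist x w <= mdist x u]).
  exact/segment_sym/(sub_segment sS).
by move=> w [].
Qed.

Lemma segment_cat S S' x y z : segment S x y -> segment S' y z ->
  mdist x z = mdist x y + mdist y z -> segment (S `|` S') x z.
Proof.
move=> sS sS' xyz; have E := segment_endpoint sS; have E' := segment_endpoint sS'.
have [[Sx Sy] iso le ex] := sS; have [[Sy' Sz] iso' le' ex'] := sS'.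
have xE v : S' v -> mdist x v = mdist x y + mdist y v.
  move=> Sv; have := E' _ Sv; have := metric_triangle x y v.
  have := metric_triangle x v z; lra.
have mix u v : S u -> S' v -> mdist u v = `|mdist x u - mdist x v|.
  move=> Su Sv; have := E _ Su; have := xE _ Sv; have := E' _ Sv.
  have := metric_triangle u y v; have := metric_triangle x u v.
  have := mdist_ge0 u y; have := mdist_ge0 y v => *.
  by rewrite ler0_norm; lra.
split.
- by split; [left|right].
- move=> u v [Su|Su] [Sv|Sv]; [exact: iso|exact: mix| |].
    by rewrite metric_sym (mix _ _ Sv Su) distrC.
  by rewrite iso'// (xE _ Su) (xE _ Sv) opprD addrACA subrr add0r.
- move=> u [/le ul|Su]; first by rewrite (le_trans ul)// xyz lerDl mdist_ge0.
  by rewrite (xE _ Su) xyz lerD2l le'.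
- move=> t t0 tl; have [txy|/ltW xyt] := leP t (mdist x y).
    by have [u Su <-] := ex t t0 txy; exists u => //; left.
  have [||u Su yu] := ex' (t - mdist x y).
  + by rewrite subr_ge0.
  + by rewrite lerBlDl -xyz.
  by exists u; [right|rewrite (xE _ Su) yu addrC subrK].
Qed.

(** A limit point [p] of [S] coincides with the point of [S] at the same distance from [x], since
    nearby points of [S] are close to both. *)
Lemma closed_segment S x y : segment S x y -> closed S.
Proof.
move=> [[Sx Sy] iso le ex]; apply/closed_mdistP => p pS.
have [||v Sv xv] := ex (mdist x p); first exact: mdist_ge0.
  apply/ler_addgt0Pr => e e0; have [u Su pu] := pS e e0.
  have := le _ Su; have := metric_triangle x u p; rewrite (metric_sym u); lra.
suff -> : p = v by [].
apply/mdist_le0/ler_addgt0Pr => e e0; rewrite add0r.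
have [|u Su pu] := pS (e / 2); first by rewrite divr_gt0.
have := metric_triangle p u v; rewrite (iso _ _ Su Sv) xv.
have : `|mdist x u - mdist x p| <= mdist p u.
  rewrite ler_norml; have := metric_triangle x u p; rewrite (metric_sym u).
  by have := metric_triangle x p u; lra.
by lra.
Qed.

(** The supremum of the distances from [x] is realized by a point of [S], and points of [F] on [S]
    accumulate there. *)
Lemma segment_last S F x y : segment S x y -> closed F -> S `&` F !=set0 ->
  exists2 p, (S `&` F) p & forall w, (S `&` F) w -> mdist x w <= mdist x p.
Proof.
move=> sS /closed_mdistP cF [q [Sq Fq]]; have [[Sx Sy] iso le ex] := sS.
pose A := [set mdist x w | w in S `&` F].
have hA : has_sup A.
  split; first by exists (mdist x q), q.
  by exists (mdist x y) => _ [w [Sw _] <-]; exact: le.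
have ubA w : S w -> F w -> mdist x w <= sup A.
  by move=> Sw Fw; apply: (ub_le_sup hA.2); exists w.
have [||p Sp xp] := ex (sup A).
- by rewrite (le_trans _ (ubA q Sq Fq))// mdist_ge0.
- by apply: ge_sup hA.1 _ => _ [w [Sw _] <-]; exact: le.
exists p; last by move=> w [Sw Fw]; rewrite xp; exact: ubA.
split => //; apply: cF => e e0.
have [_ [w [Sw Fw] <-] ew] := sup_adherent e0 hA.
exists w => //; rewrite iso// xp ger0_norm ?subr_ge0 ?ubA//; lra.
Qed.

Lemma segment_first S F x y : segment S x y -> closed F -> S `&` F !=set0 ->
  exists2 p, (S `&` F) p & forall w, (S `&` F) w -> mdist x p <= mdist x w.
Proof.
move=> sS cF SF0; have [p [Sp Fp] pm] := segment_last (segment_sym sS) cF SF0.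
exists p => // w [Sw Fw]; have := pm w (conj Sw Fw).
have := segment_endpoint sS Sp; have := segment_endpoint sS Sw.
by rewrite !(metric_sym _ y); lra.
Qed.

Lemma geodesic_segment M x y : geodesic_set M -> M x -> M y ->
  exists2 S, segment S x y & S `<=` M.
Proof.
move=> gM Mx My; have [l [g [l0 iso g0 gl gMl]]] := gM _ _ Mx My.
exists (g @` `[0, l]) => //.
have in0 : `[0, l]%classic 0 by rewrite /= in_itv/= lexx.
have inl : `[0, l]%classic l by rewrite /= in_itv/= lexx andbT.
have xE t : `[0, l]%classic t -> mdist x (g t) = t.
  move=> tl; rewrite -g0 iso// sub0r normrN ger0_norm//.
  by move: tl; rewrite /= in_itv/= => /andP[].
have xy : mdist x y = l by rewrite -gl xE.
split.
- by split; [exists 0|exists l].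
- by move=> _ _ [s sl <-] [t tl <-]; rewrite iso// !xE.
- move=> _ [s sl <-]; rewrite xE// xy.
  by move: sl; rewrite /= in_itv/= => /andP[].
- rewrite xy => t t0 tl; have tI : `[0, l]%classic t by rewrite /= in_itv/= t0.
  by exists (g t); [exists t|exact: xE].
Qed.

Lemma segment_param S x y : segment S x y ->
  exists g : R -> T, forall t, 0 <= t <= mdist x y -> S (g t) /\ mdist x (g t) = t.
Proof.
move=> [_ _ _ ex].
have /choice[g gP] : forall t, exists u, 0 <= t <= mdist x y ->
    S u /\ mdist x u = t.
  move=> t; have [/andP[t0 tl]|_] := boolP (0 <= t <= mdist x y).
    by have [u Su xu] := ex t t0 tl; exists u.
  by exists x.
by exists g.
Qed.

End segments.

(** * Triangles in tree-graded spaces *)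

Section tree_graded_spaces.
Context {R : realType} {T : metricType R} {Pc : set (set T)}.
Hypothesis Ttg : tree_graded Pc.
Implicit Types (S M N : set T) (x y z u v w p q r a b c e : T).

(** This turns three sides given as sets into the parametrized loop of the definition of
    tree-graded. Sides meeting only at common vertices make the loop simple, and [a <> b] makes its
    length positive; the other two sides may degenerate. *)
Lemma simple_triangle S1 S2 S3 a b c :
    segment S1 a b -> segment S2 b c -> segment S3 c a -> a <> b ->
    (forall z, S1 z -> S2 z -> z = b) -> (forall z, S2 z -> S3 z -> z = c) ->
    (forall z, S3 z -> S1 z -> z = a) ->
  exists N, [/\ Pc N, S1 `<=` N, S2 `<=` N & S3 `<=` N].
Proof.
move=> s1 s2 s3 ab e12 e23 e31.
have [g1 g1P] := segment_param s1; have [g2 g2P] := segment_param s2.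
have [g3 g3P] := segment_param s3.
have [_ iso1 _ _] := s1; have [_ iso2 _ _] := s2; have [_ iso3 _ _] := s3.
set l1 := mdist a b in g1P; set l2 := mdist b c in g2P.
set l3 := mdist c a in g3P.
have l10 : 0 < l1 by rewrite mdist_gt0; apply/eqP.
have l20 : 0 <= l2 by exact: mdist_ge0.
have l30 : 0 <= l3 by exact: mdist_ge0.
(* The three formulas agree at the junctions, so [f1], [f2] and [f3] hold on closed intervals. *)
pose f t := if t <= l1 then g1 t else
            if t <= l1 + l2 then g2 (t - l1) else g3 (t - (l1 + l2)).
have endE S x y g : segment S x y ->
    (forall t, 0 <= t <= mdist x y -> S (g t) /\ mdist x (g t) = t) ->
    g 0 = x /\ g (mdist x y) = y.
  move=> sS gP; have [[Sx Sy] _ _ _] := sS.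
  have [|S0 x0] := gP 0; first by rewrite lexx mdist_ge0.
  have [|Sl xl] := gP (mdist x y); first by rewrite lexx mdist_ge0.
  by split; apply: (segment_inj sS) => //; rewrite x0 mdistxx.
have [g10 g1l] := endE _ _ _ _ s1 g1P; have [g20 g2l] := endE _ _ _ _ s2 g2P.
have [g30 g3l] := endE _ _ _ _ s3 g3P.
have f1 t : 0 <= t <= l1 -> f t = g1 t by move=> /andP[_ tl]; rewrite /f tl.
have f2 t : l1 <= t <= l1 + l2 -> f t = g2 (t - l1).
  move=> /andP[lt tl]; rewrite /f tl; case: ifPn => // tl1.
  have -> : t = l1 by apply/eqP; rewrite eq_le lt tl1.
  by rewrite subrr g20 g1l.
have f3 t : l1 + l2 <= t <= l1 + l2 + l3 -> f t = g3 (t - (l1 + l2)).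
  move=> /andP[lt tl]; have [tl2|tl2] := leP t (l1 + l2); last first.
    by rewrite /f leNgt (le_lt_trans _ tl2) ?lerDl//= leNgt tl2.
  have -> : t = l1 + l2 by apply/eqP; rewrite eq_le lt tl2.
  rewrite f2; last by lra.
  by rewrite subrr g30 addrAC subrr add0r g2l.
have F1 t : 0 <= t <= l1 -> S1 (f t) /\ mdist a (f t) = t.
  by move=> tl; rewrite f1//; exact: g1P.
have F2 t : l1 <= t <= l1 + l2 -> S2 (f t) /\ mdist b (f t) = t - l1.
  by move=> tl; rewrite f2//; apply: g2P; lra.
have F3 t : l1 + l2 <= t <= l1 + l2 + l3 ->
    S3 (f t) /\ mdist c (f t) = t - (l1 + l2).
  by move=> tl; rewrite f3//; apply: g3P; lra.
have [_ _ _ T2] := Ttg; have [|N PN fN] := T2 f l1 (l1 + l2) (l1 + l2 + l3).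
  split.
  - by split; lra.
  - split=> s t; rewrite /= !in_itv/= => sl tl.
    + by have [? Es] := F1 s sl; have [? Et] := F1 t tl; rewrite iso1// Es Et.
    + have [? Es] := F2 s sl; have [? Et] := F2 t tl; rewrite iso2// Es Et.
      by congr (`|_|); lra.
    + have [? Es] := F3 s sl; have [? Et] := F3 t tl; rewrite iso3// Es Et.
      by congr (`|_|); lra.
  - rewrite f1 ?lexx ?ltW// g10 f3; last by rewrite lexx andbT lerDl.
    by rewrite addrAC subrr add0r g3l.
  (* On one side, the distance to its first vertex tells the parameters apart. On two different
     sides, a common value is a shared vertex, and this forces [t] to be the parameter of a junction
     already passed or the excluded final one. *)
  - have key s t : 0 <= s -> s < t -> t < l1 + l2 + l3 -> f s <> f t.
      move=> s0 st tl; have [tl1|tl1] := leP t l1.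
        have [|_ Es] := F1 s; first by lra.
        by have [|_ Et] := F1 t; first (by lra); move=> E; move: Es; rewrite E Et; lra.
      have [tl2|tl2] := leP t (l1 + l2).
        have [|St Et] := F2 t; first by lra.
        have [sl1|sl1] := leP s l1.
          have [|Ss Es] := F1 s; first by lra.
          move=> E; rewrite -E in St Et; have := e12 _ Ss St.
          by move=> Eb; move: Et; rewrite Eb mdistxx; lra.
        have [|Ss Es] := F2 s; first by lra.
        by move=> E; move: Es; rewrite E Et; lra.
      have [|St Et] := F3 t; first by lra.
      have [sl1|sl1] := leP s l1.
        have [|Ss Es] := F1 s; first by lra.
        move=> E; rewrite -E in St Et; have := e31 _ St Ss.
        by move=> Eb; move: Et; rewrite Eb; rewrite -/l3; lra.
      have [sl2|sl2] := leP s (l1 + l2).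
        have [|Ss Es] := F2 s; first by lra.
        move=> E; rewrite -E in St Et; have := e23 _ Ss St.
        by move=> Eb; move: Et; rewrite Eb mdistxx; lra.
      have [|Ss Es] := F3 s; first by lra.
      by move=> E; move: Es; rewrite E Et; lra.
    move=> s t; rewrite !in_itv/= => /andP[s0 sl] /andP[t0 tl] E.
    have [st|ts|//] := ltgtP s t; first by have := key s t s0 st tl.
    by case: (key t s t0 ts sl); rewrite E.
exists N; split=> // u Su; apply: fN.
- have [_ _ le _] := s1; have ul := le u Su.
  have tl : 0 <= mdist a u <= l1 by rewrite mdist_ge0 ul.
  exists (mdist a u); first by rewrite /= in_itv/=; lra.
  by have [? E] := F1 _ tl; apply: (segment_inj s1).
- have [_ _ le _] := s2; have ul := le u Su; have u0 := mdist_ge0 b u.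
  have tl : l1 <= l1 + mdist b u <= l1 + l2 by rewrite lerD2l ul lerDl u0.
  exists (l1 + mdist b u); first by rewrite /= in_itv/=; lra.
  have [? E] := F2 _ tl; apply: (segment_inj s2) => //; rewrite E; lra.
- have [_ _ le _] := s3; have ul := le u Su; have u0 := mdist_ge0 c u.
  have tl : l1 + l2 <= l1 + l2 + mdist c u <= l1 + l2 + l3.
    by rewrite lerD2l ul lerDl u0.
  exists (l1 + l2 + mdist c u); first by rewrite /= in_itv/=; lra.
  have [? E] := F3 _ tl; apply: (segment_inj s3) => //; rewrite E; lra.
Qed.

(** Cutting [S2] at its midpoint turns the bigon into a simple triangle. *)
Lemma simple_bigon S1 S2 a b : segment S1 a b -> segment S2 a b -> a <> b ->
    (forall z, S1 z -> S2 z -> z = a \/ z = b) ->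
  exists2 N, Pc N & S1 `<=` N.
Proof.
move=> s1 s2 ab e12; have ab0 : 0 < mdist a b by rewrite mdist_gt0; apply/eqP.
have [[Sa Sb] _ le ex] := s2.
have [||m Sm am] := ex (mdist a b / 2); [by lra|by lra|].
have sm := sub_segment s2 Sa Sm; have mb := sub_segment s2 Sm Sb.
rewrite mdistxx am in sm mb.
have {}sm : segment (S2 `&` [set w | 0 <= mdist a w <= mdist a b / 2]) a m.
  by apply: sm; lra.
have {mb}mb : segment (S2 `&` [set w | mdist a b / 2 <= mdist a w <= mdist a b]) m b.
  by apply: mb; lra.
have [|z Sz [Sz' /andP[_ z2]]|z [Sz /andP[_ z1]] [Sz' /andP[z2 _]]
  |z [Sz /andP[z1 _]] Sz'|N [PN S1N _ _]]
  := @simple_triangle _ _ _ b a m (segment_sym s1) sm mb.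
- exact: nesym.
- by case: (e12 _ Sz Sz') => // zb; exfalso; move: z2; rewrite zb; lra.
- by apply: (segment_inj s2) => //; rewrite am; lra.
- by case: (e12 _ Sz' Sz) => // za; exfalso; move: z1; rewrite za mdistxx; lra.
- by exists N.
Qed.

(** If [Be] or [Ga] contains both [p] and [p'], there is a simple bigon. Otherwise follow [Be] from
    [p] towards [y] up to its first point [r] on [Ga], then [Ga] to [p']; this closes a simple
    triangle with [Al]. *)
Lemma piece_of_detour Al Be Ga p p' y x z :
    segment Al p p' -> segment Be x y -> segment Ga y z -> Be p -> Ga p' ->
    p <> p' -> (forall w, Al w -> Be w \/ Ga w -> w = p \/ w = p') ->
  exists2 N, Pc N & Al `<=` N.
Proof.
move=> sA sB sG Bp Gp' pp' H.
have [Gp|nGp] := pselect (Ga p).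
  have [S' s' S'G] := segment_between sG Gp Gp'.
  apply: (simple_bigon sA s' pp') => w Aw /S'G Gw.
  by apply: H => //; right.
have [Bp'|nBp'] := pselect (Be p').
  have [S' s' S'B] := segment_between sB Bp Bp'.
  apply: (simple_bigon sA s' pp') => w Aw /S'B Bw.
  by apply: H => //; left.
have [[_ By] _ _ _] := sB; have [[Gy _] _ _ _] := sG.
have [B' sB' B'B] := segment_between sB Bp By.
have [[_ B'y] _ _ _] := sB'.
have [|r [Br Gr] rmin] := segment_first sB' (closed_segment sG).
  by exists y.
have [[B'p _] _ _ _] := sB'.
have [S2 s2 S2G] := segment_between sG Gr Gp'.
have s1 := sub_segment sB' B'p Br; rewrite mdistxx in s1.
have {}s1 := s1 (mdist_ge0 p r).
have pr : p <> r by move=> E; apply: nGp; rewrite E.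
have [z' [Sz /andP[_ zr]] /S2G Gz|z' /S2G Gz Az|z' Az [/B'B Bz _]|N [PN _ _ AN]]
  := simple_triangle s1 s2 (segment_sym sA) pr.
- apply: (segment_inj sB') => //; apply/eqP.
  by rewrite eq_le zr rmin.
- by case: (H _ Az (or_intror Gz)) => // E; case: nGp; rewrite -E.
- by case: (H _ Az (or_introl Bz)) => // E; case: nBp'; rewrite -E.
- by exists N.
Qed.

(** The points [p] and [p'] are the last before [u] and the first after [u] at which [Al] meets the
    other two sides. Between them [Al] is free of these sides, so it closes to a simple bigon or
    triangle, whichever sides contain [p] and [p']. *)
Lemma piece_of_triangle_gap Al Be Ga x y z u :
    segment Al x z -> segment Be x y -> segment Ga y z ->
    Al u -> ~ Be u -> ~ Ga u ->
  exists N p p', [/\ Pc N, Al p /\ Al p', Be p \/ Ga p, Be p' \/ Ga p' &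
    mdist x p < mdist x u < mdist x p' /\
    forall w, Al w -> mdist x p <= mdist x w <= mdist x p' -> N w].
Proof.
move=> sA sB sG Au nBu nGu.
have [[Ax Az] iso le _] := sA; have [[Bx By] _ _ _] := sB; have [[Gy Gz] _ _ _] := sG.
have cF : closed (Be `|` Ga).
  by apply: closedU; [exact: closed_segment sB|exact: closed_segment sG].
have sxu := sub_segment sA Ax Au; rewrite mdistxx in sxu.
have {sxu} := sxu (mdist_ge0 x u); set A1 := _ `&` _ => sA1.
have := sub_segment sA Au Az (le _ Au); set A2 := _ `&` _ => sA2.
have [|p [[Ap pu] Fp] pmax] := segment_last sA1 cF.
  by exists x; split; [split=> //=; rewrite mdistxx lexx mdist_ge0|left].
have [|p' [[Ap' up'] Fp'] pmin] := segment_first sA2 cF.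
  by exists z; split; [split=> //=; rewrite lexx andbT le|right].
move: pu up' => /= /andP[_ pu] /andP[up' _].
have nFu q : Be q \/ Ga q -> q <> u by move=> Fq E; move: Fq; rewrite E => -[].
have xpu : mdist x p < mdist x u.
  rewrite lt_neqAle pu andbT; apply/eqP => E; apply: (nFu _ Fp).
  exact: (segment_inj sA).
have xup' : mdist x u < mdist x p'.
  rewrite lt_neqAle up' andbT; apply/eqP => E; apply: (nFu _ Fp').
  by apply: (segment_inj sA).
have pp' : p <> p' by move=> E; move: xpu; rewrite E ltNge (ltW xup').
have := sub_segment sA Ap Ap' (ltW (lt_trans xpu xup')); set A' := _ `&` _ => sA'.
have only w : A' w -> Be w \/ Ga w -> w = p \/ w = p'.
  move=> [Aw /= /andP[pw wp']] Fw.
  have [wu|/ltW uw] := leP (mdist x w) (mdist x u).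
    left; apply: (segment_inj sA) => //; apply/eqP; rewrite eq_le pw andbT.
    by apply: pmax; split=> //; split=> //=; rewrite mdist_ge0 wu.
  right; apply: (segment_inj sA) => //; apply/eqP; rewrite eq_le wp' /=.
  have := pmin w; rewrite (iso u p')// (iso u w)// !ler0_norm ?subr_le0//.
  suff A2w : A2 w by move=> /(_ (conj A2w Fw)); lra.
  by split=> //=; rewrite uw le.
suff [N PN A'N] : exists2 N, Pc N & A' `<=` N.
  by exists N, p, p'; split => //; split; [rewrite xpu xup'|move=> w Aw pw; apply: A'N].
have [Bp|nBp] := pselect (Be p); have [Gp'|nGp'] := pselect (Ga p').
- exact: (piece_of_detour sA' sB sG).
- have Bp' : Be p' by case: Fp'.
  have [S' s' S'B] := segment_between sB Bp Bp'.
  apply: (simple_bigon sA' s' pp') => w Aw /S'B Bw.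
  by apply: only => //; left.
- have Gp : Ga p by case: Fp.
  have [S' s' S'G] := segment_between sG Gp Gp'.
  apply: (simple_bigon sA' s' pp') => w Aw /S'G Gw.
  by apply: only => //; right.
- have Gp : Ga p by case: Fp.
  have Bp' : Be p' by case: Fp'.
  apply: (@piece_of_detour A' Ga Be p p' y z x) => //; try exact: segment_sym.
  by move=> w Aw [|] ?; apply: only => //; [right|left].
Qed.

End tree_graded_spaces.

(** * Projection to a piece, and sets without cut points *)

(** As [e] is not in [E], the trace of [V] on [E] is both open and closed. *)
Lemma connected_sub_clopen (T : topologicalType) (E V : set T) (e x : T) :
    connected E -> open V -> closed (V `|` [set e]) -> ~ E e -> E x -> V x ->
  E `<=` V.
Proof.
move=> cE oV cV nEe Ex Vx; have <- : E `&` V = E; last by move=> ? [].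
apply: cE; [by exists x|by exists V|exists (V `|` [set e]) => //].
apply/seteqP; split=> z [Ez]; first by move=> Vz; split=> //; left.
by move=> [Vz|/= ze]; [split|move: Ez; rewrite ze].
Qed.

Section basins.
Context {R : realType} {T : metricType R} {Pc : set (set T)}.
Hypothesis Ttg : tree_graded Pc.
Implicit Types (S M N E : set T) (x y z u v w p q r a b c e : T).

Lemma tree_graded_segment x y : exists S, segment S x y.
Proof.
have [[_ gT] _ _ _] := Ttg.
by have [S sS _] := geodesic_segment gT (I : [set: T] x) (I : [set: T] y); exists S.
Qed.

Lemma piece_eq M N a b : Pc M -> Pc N -> M a -> N a -> M b -> N b -> a <> b ->
  M = N.
Proof.
move=> PM PN Ma Na Mb Nb ab; apply: contrapT => MN; apply: ab.
by have [_ _ /(_ _ _ PM PN MN) + _] := Ttg; apply.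
Qed.

Lemma entrance M x m : closed M -> M m -> exists e S,
  [/\ M e, segment S x e, forall w, S w -> M w -> w = e &
      mdist x m = mdist x e + mdist e m].
Proof.
move=> cM Mm; have [S sS] := tree_graded_segment x m.
have [[Sx Sm] _ _ _] := sS.
have [|e [Se Me] emin] := segment_first sS cM; first by exists m.
have := sub_segment sS Sx Se; rewrite mdistxx => /(_ (mdist_ge0 _ _)) s1.
exists e; eexists; split; [exact: Me|exact: s1| |].
  move=> w [Sw /= /andP[_ we]] Mw; apply: (segment_inj sS) => //.
  by apply/eqP; rewrite eq_le we emin.
by rewrite (segment_endpoint sS).
Qed.

(** If [m1] and [m2] differed, the last common point [p] of the two segments and a geodesic of [M]
    from [m1] to [m2] would span a simple triangle. Its piece shares [m1] and [m2] with [M], hence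
    equals [M], so [p] would lie in [M] before the entrance. *)
Lemma entrance_unique M x m1 m2 S1 S2 : Pc M -> ~ M x -> M m1 -> M m2 ->
    segment S1 x m1 -> segment S2 x m2 ->
    (forall w, S1 w -> M w -> w = m1) -> (forall w, S2 w -> M w -> w = m2) ->
  m1 = m2.
Proof.
move=> PM nMx Mm1 Mm2 s1 s2 e1 e2; apply: contrapT => m12.
have [[S1x S1m] _ le1 _] := s1; have [[S2x S2m] _ le2 _] := s2.
have [|p [S1p S2p] pmax] := segment_last s1 (closed_segment s2).
  by exists x.
have pm1 : p <> m1 by move=> E; apply: m12; apply: e2 => //; rewrite -E.
have [_ /(_ _ PM)[_ gM] _ _] := Ttg.
have [Sm sm SmM] := geodesic_segment gM Mm1 Mm2.
have t1 := sub_segment s1 S1p S1m (le1 _ S1p).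
have t2 := sub_segment s2 S2p S2m (le2 _ S2p).
have [z [S1z _] /SmM Mz|z /SmM Mz [S2z _]|z [S2z /= _] [S1z /= /andP[pz _]]|N] :=
  simple_triangle Ttg t1 sm (segment_sym t2) pm1.
- exact: e1.
- exact: e2.
- by apply: (segment_inj s1) => //; apply/eqP; rewrite eq_le pz andbT pmax.
- move=> [PN t1N smN t2N].
  have [[Sm1 Sm2] _ _ _] := sm; have [[t1p _] _ _ _] := t1.
  have MN := piece_eq PM PN Mm1 (smN _ Sm1) Mm2 (smN _ Sm2) m12.
  by apply: pm1; apply: e1 => //; rewrite MN; exact: t1N.
Qed.

(* The points outside the piece [M] that project to [e]. *)
Definition basin M e : set T :=
  [set x | [/\ ~ M x, M e & forall m, M m -> mdist x m = mdist x e + mdist e m]].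

Lemma basin_exists M x : Pc M -> M !=set0 -> ~ M x -> exists e, basin M e x.
Proof.
move=> PM [m0 Mm0] nMx; have [_ /(_ _ PM)[cM _] _ _] := Ttg.
have [e [S [Me sS Se _]]] := entrance x cM Mm0.
exists e; split=> // m Mm; have [e' [S' [Me' sS' Se' ->]]] := entrance x cM Mm.
by rewrite (entrance_unique PM nMx Me Me' sS sS').
Qed.

Lemma basin_unique M e e' x : basin M e x -> basin M e' x -> e = e'.
Proof.
move=> [_ Me H] [_ Me' H']; apply: mdist_le0.
have := H _ Me'; have := H' _ Me; have := mdist_ge0 e e'.
by rewrite (metric_sym e' e); lra.
Qed.

(** Suppose [y] projects to another point [e']. The path from [x] through [e] to [e'] is geodesic;
    compare it with the triangle through [y]. The side from [x] to [y] is too short to reach [M],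
    and the side from [y] to [e'] meets [M] only at [e']. The gap around the midpoint [u] of the
    part in [M] lies in a piece sharing two points with [M], hence in [M]; but it starts on one of
    the two other sides. *)
Lemma basin_ball M e x y : Pc M -> basin M e x -> mdist x y < mdist x e ->
  basin M e y.
Proof.
move=> PM [nMx Me xM] xye.
have far w : mdist x w <= mdist x y -> ~ M w.
  by move=> xw /xM; have := mdist_ge0 e w; lra.
have [|||e' By] := @basin_exists M y => //; [by exists e|exact: far|].
have [->//|/eqP ee'] := eqVneq e e'.
have [nMy Me' yM] := By.
have [_ /(_ _ PM)[cM gM] _ _] := Ttg.
have [S1 s1] := tree_graded_segment x e.
have [Sm sm SmM] := geodesic_segment gM Me Me'.
have [Be sB] := tree_graded_segment x y.
have [Ga sG] := tree_graded_segment y e'.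
have sA := segment_cat s1 sm (xM _ Me').
have ee'0 : 0 < mdist e e' by rewrite mdist_gt0; apply/eqP.
have [_ _ le1 _] := s1; have [_ _ leA _] := sA; have [_ _ leB _] := sB.
have [_ _ _ /(_ (mdist e e' / 2))[||u Su eu]] := sm; [lra|lra|].
have GaM w : Ga w -> M w -> w = e'.
  move=> Gw /yM; have := segment_endpoint sG Gw; rewrite (metric_sym w e').
  have := mdist_ge0 e' w => *.
  by apply/esym/mdist_le0; lra.
have xu : mdist x u = mdist x e + mdist e e' / 2 by rewrite xM ?eu//; exact: SmM.
have [|||N [p [p' [PN [Ap Ap'] Fp Fp' [/andP[pu up'] AN]]]]] :=
    piece_of_triangle_gap Ttg sA sB sG (u := u).
- by right.
- by move=> /leB/far; apply; exact: SmM.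
- by move=> Gu; move: eu; rewrite (GaM _ Gu (SmM _ Su)); lra.
have Mp' : M p'.
  case: Ap' => [/le1|/SmM//]; move: up'; rewrite xu; lra.
have MN : M = N.
  apply: (@piece_eq M N u p') => //.
  + exact: SmM.
  + by apply: AN; [right|rewrite (ltW pu) (ltW up')].
  + by apply: AN => //; rewrite lexx andbT (ltW (lt_trans pu up')).
  + by move=> E; move: up'; rewrite E ltxx.
have Mp : M p by rewrite MN; apply: AN => //; rewrite lexx (ltW (lt_trans pu up')).
case: Fp => [/leB/far//|/GaM/(_ Mp) pe'].
by move: pu (leA _ Ap') up'; rewrite pe'; lra.
Qed.

Lemma open_basin M e : Pc M -> open (basin M e).
Proof.
move=> PM; apply/open_mdistP => p Bp; exists (mdist p e).
  by rewrite mdist_gt0; apply/eqP => pe; case: Bp; rewrite pe.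
by move=> q; exact: basin_ball.
Qed.

(** A point outside is either another point [q] of [M], which geodesics from the basin reach only
    through [e], or a point of another basin, which is open and disjoint from this one. *)
Lemma closed_basin M e : Pc M -> M e -> closed (basin M e `|` [set e]).
Proof.
move=> PM Me; rewrite -openC; apply/open_mdistP => q.
rewrite /= not_orP => -[nBq /= qe].
have [Mq|nMq] := pselect (M q).
  exists (mdist e q); first by rewrite mdist_gt0; apply/eqP/nesym.
  move=> z qz [[_ _ /(_ _ Mq) zq]|/= ze].
    by move: qz; rewrite metric_sym zq; have := mdist_ge0 z e; lra.
  by move: qz; rewrite ze metric_sym ltxx.
have [|e' Be'] := basin_exists PM _ nMq; first by exists e.
have /open_mdistP/(_ q Be')[r r0 rB] := @open_basin M e' PM.
exists r => // z /rB Bz [Be|/= ze].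
  by apply: nBq; rewrite (basin_unique Be Bz).
by case: Bz; rewrite ze.
Qed.

(** The only exit from a basin is its projection point [e]. *)
Lemma connected_basin M E e x : Pc M -> connected E -> ~ E e -> E x ->
  basin M e x -> E `<=` basin M e.
Proof.
move=> PM cE nEe Ex Bx; have [_ Me _] := Bx.
apply: (connected_sub_clopen cE _ _ nEe Ex Bx); first exact: open_basin.
exact: closed_basin.
Qed.

(* If no piece contains a subsegment of [S], then each inner point [u] of [S]
   separates the endpoints of [S]. *)
Lemma transverse_segment_separates S a b u : segment S a b -> S u ->
    (forall N p, Pc N -> S p -> mdist a p < mdist a u ->
      exists2 w, S w /\ mdist a p <= mdist a w <= mdist a u & ~ N w) ->
  let V := [set x | mdist a x < mdist a u + mdist u x] in
  open V /\ closed (V `|` [set u]).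
Proof.
move=> sS Su tr V; split.
  apply/open_mdistP => x; rewrite /V/= => Vx.
  exists ((mdist a u + mdist u x - mdist a x) / 2); first by lra.
  move=> y xy; have := metric_triangle a x y; have := metric_triangle u y x.
  by rewrite (metric_sym y x); lra.
rewrite -openC; apply/open_mdistP => y.
rewrite /= not_orP => -[/negP]; rewrite -leNgt => yV /= yu.
exists (mdist u y); first by rewrite mdist_gt0; apply/eqP/nesym.
move=> z yz [Vz|/= zu]; last by move: yz; rewrite zu metric_sym ltxx.
(* Hence a geodesic from [a] to [y] runs through [u]. A path through a point [z] of [V] close to [y]
   misses [u], so the gap at [u] gives a piece containing a final part of [S] before [u], against
   [tr]. *)
have ayE : mdist a y = mdist a u + mdist u y.
  by have := metric_triangle a u y; lra.
have [[Sa Sb] _ _ _] := sS.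
have [G sG] := tree_graded_segment u y.
have := sub_segment sS Sa Su; rewrite mdistxx => /(_ (mdist_ge0 _ _)) s1.
have sA := segment_cat s1 sG ayE; have [[_ s1u] _ _ _] := s1.
have [Be sB] := tree_graded_segment a z.
have [Ga sGa] := tree_graded_segment z y.
have [|||N [p [p' [PN [Ap Ap'] _ _ [/andP[pu up'] AN]]]]] :=
    piece_of_triangle_gap Ttg sA sB sGa (u := u).
- by left.
- by move=> /(segment_endpoint sB) E; move: Vz; rewrite /V/= E ltxx.
- move=> /(segment_endpoint sGa); move: yz; rewrite (metric_sym y z).
  by have := mdist_ge0 z u; lra.
case: Ap => [[Sp _]|Gp].
  have [w [Sw /andP[pw wu]]] := tr N p PN Sp pu; apply.
  apply: AN; last by rewrite pw (le_trans wu)// ltW.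
  by left; split=> //=; rewrite mdist_ge0 wu.
have := segment_endpoint sG Gp; have := metric_triangle a p y.
by have := mdist_ge0 u p; lra.
Qed.

(** If some piece [N] contains two points of a geodesic from [a] to [b], then a point of [E] outside
    [N] would drag all of [E], except perhaps one point, into a single basin of [N]; this is
    excluded first for [a] and [b], then for every other point. If there is no such piece, the
    midpoint of the geodesic separates [a] from [b] in [E]. *)
Lemma sub_piece_of_no_cut_point E a b : E a -> E b -> a <> b ->
    (forall p, connected (E `\ p)) ->
  exists2 N, Pc N & E `<=` N.
Proof.
move=> Ea Eb ab cE; have [S sS] := tree_graded_segment a b.
have [[Sa Sb] iso le ex] := sS.
have ab0 : 0 < mdist a b by rewrite mdist_gt0; apply/eqP.
have [[N [p [p' [PN Sp Sp' pp' [Np Np']]]]]|noN] := pselect (exists N p p',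
    [/\ Pc N, S p, S p', mdist a p < mdist a p' & N p /\ N p']).
  have N0 : N !=set0 by exists p.
  have pE := segment_endpoint sS Sp; have p'E := segment_endpoint sS Sp'.
  (* This is where the connectedness of [E] minus the point [e] enters. *)
  have into c e : E c -> basin N e c -> forall w, E w -> w <> e -> basin N e w.
    move=> Ec Bc w Ew we; apply: (connected_basin PN (cE e) _ _ Bc) => //.
    - by move=> [_]; apply.
    - by split=> //= ce; case: Bc => nNc Ne _; apply: nNc; rewrite ce.
  have Na : N a.
    apply: contrapT => /(basin_exists PN N0)[e Ba].
    have [_ Ne aN] := Ba; have ap := aN _ Np; have ap' := aN _ Np'.
    have := mdist_ge0 e p; have := mdist_ge0 e p'.
    have [be|/eqP be] := eqVneq b e.
      have := mdist_ge0 p b; have := mdist_ge0 p' b.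
      by move: ap ap' pE p'E; rewrite -be; lra.
    have [_ _ bN] := into _ _ Ea Ba _ Eb be.
    have bp := bN _ Np; have bp' := bN _ Np'.
    have := metric_triangle a e b; rewrite (metric_sym e b).
    move: pE p'E; rewrite (metric_sym p b) (metric_sym p' b); lra.
  have Nb : N b.
    apply: contrapT => /(basin_exists PN N0)[e Bb].
    have [ae|/eqP ae] := eqVneq a e; last by case: (into _ _ Eb Bb _ Ea ae).
    have [_ Ne bN] := Bb; have bp := bN _ Np; have bp' := bN _ Np'.
    move: pE p'E bp bp'; rewrite -ae !(metric_sym b) => *.
    by have := mdist_ge0 a p; have := mdist_ge0 a p'; lra.
  exists N => // c Ec; apply: contrapT => /(basin_exists PN N0)[e Bc].
  have [ae|/eqP ae] := eqVneq a e; last by case: (into _ _ Ec Bc _ Ea ae).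
  by case: (into _ _ Ec Bc _ Eb) => //; rewrite -ae; exact: nesym.
have [||u Su au] := ex (mdist a b / 2); [lra|lra|].
have [||oV cV] := @transverse_segment_separates S a b u sS.
- exact: Su.
- move=> N p PN Sp pu; apply: contrapT => H; apply: noN.
  have NS w : S w -> mdist a p <= mdist a w <= mdist a u -> N w.
    by move=> Sw wp; apply: contrapT => nNw; apply: H; exists w.
  exists N, p, u; split=> //; split; apply: NS => //.
    by rewrite lexx ltW.
  by rewrite lexx andbT ltW.
have ub := segment_endpoint sS Su; rewrite au in ub.
have uneq c : mdist u c = mdist a b / 2 -> c <> u.
  by move=> uc cu; move: uc; rewrite cu mdistxx; lra.
have au' : mdist u a = mdist a b / 2 by rewrite metric_sym.
have ub' : mdist u b = mdist a b / 2 by lra.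
have := connected_sub_clopen (cE u) oV cV (x := a).
have sub : (E `\ u) a /\ (E `\ u) b by split; split=> //; exact: uneq.
move=> /(_ _ sub.1 _ b sub.2); rewrite /= mdistxx ub' au -splitr => H.
have : mdist a b < mdist a b by apply: H; [move=> [_]; apply|lra].
by rewrite ltxx.
Qed.

End basins.

(** * Ultralimits *)

Section tnbhd.
Context {R : realType} {Y : metricType R}.
Implicit Types (A : set Y) (x y : Y) (r s : R).

Lemma tnbhdP r A x : tnbhd r A x <-> exists2 a, A a & mdist x a < r.
Proof.
by split=> -[a Aa ax]; exists a => //; move: ax;
  rewrite /= ballEmdist /= metric_sym.
Qed.

Lemma tnbhd_shift r s A x y : tnbhd r A x -> mdist x y <= s ->
  tnbhd (r + s) A y.
Proof.
move=> /tnbhdP[a Aa xa] xy; apply/tnbhdP; exists a => //.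
by have := metric_triangle y x a; rewrite (metric_sym y x); lra.
Qed.

Lemma tnbhdS r s A x : r <= s -> tnbhd r A x -> tnbhd s A x.
Proof.
by move=> rs /tnbhdP[a Aa xa]; apply/tnbhdP; exists a => //; exact: lt_le_trans rs.
Qed.

End tnbhd.

Section ultralimits.
Context {R : realType} {w : nonprincipal_ultrafilter} {X : nat -> metricType R}
  {x : forall n, X n} {d : scaling R w}.
Implicit Types (u v : bounded_seq x d) (c e : R).

Lemma near_scaling (D : R) : \forall n \near ultra_sets w, D <= d n.
Proof. by have /cvgryPge := @scaling_infty R w d; apply. Qed.

Lemma near_scaling_small (D e : R) : 0 < e ->
  \forall n \near ultra_sets w, D <= e * d n.
Proof.
move=> e0; apply: filterS (near_scaling (D / e)) => n.
by rewrite ler_pdivrMr// mulrC.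
Qed.

Lemma ulim_mdist_le u v c :
    (\forall n \near ultra_sets w, mdist (u n) (v n) <= c * d n) ->
  mdist (ulim_class u) (ulim_class v) <= c.
Proof.
move=> H; rewrite mdist_ulim_class /ulim_dist.
apply: limr_le; first exact: scaled_dist_cvg.
by apply: filterS H => n; rewrite /scaled_dist ler_pdivrMr// scaling_gt0.
Qed.

Lemma ulim_mdist_ge u v c :
    (\forall n \near ultra_sets w, c * d n <= mdist (u n) (v n)) ->
  c <= mdist (ulim_class u) (ulim_class v).
Proof.
move=> H; rewrite mdist_ulim_class /ulim_dist.
apply: limr_ge; first exact: scaled_dist_cvg.
by apply: filterS H => n; rewrite /scaled_dist ler_pdivlMr// scaling_gt0.
Qed.

Lemma near_ulim_mdist_lt u v c : mdist (ulim_class u) (ulim_class v) < c ->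
  \forall n \near ultra_sets w, mdist (u n) (v n) < c * d n.
Proof.
rewrite mdist_ulim_class /ulim_dist => uvc.
have H : \forall n \near ultra_sets w, scaled_dist u v n < c.
  exact: cvgr_lt (@scaled_dist_cvg _ _ _ _ _ u v) _ uvc.
apply: filterS H => n.
by rewrite /scaled_dist ltr_pdivrMr// scaling_gt0.
Qed.

Lemma ulim_classP (z : ultralimit x d) : exists u, z = ulim_class u.
Proof.
exists (repr (z : {eq_quot @ulim_equiv R w X x d}%qT)).
by rewrite /ulim_class reprK.
Qed.

Lemma bounded_seq_exists (s : forall n, X n) c :
    (\forall n \near ultra_sets w, mdist (x n) (s n) <= c * d n) ->
  exists u, bseq_val u = s.
Proof.
move=> H; suff bs : exists B : R,
    \forall n \near ultra_sets w, mdist (x n) (s n) / d n <= B.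
  by exists (BoundedSeq bs).
by exists c; apply: filterS H => n; rewrite ler_pdivrMr// scaling_gt0.
Qed.

Lemma near_bounded_seq u : exists c,
  \forall n \near ultra_sets w, mdist (x n) (u n) <= c * d n.
Proof.
have [B uB] := bseq_bounded u; exists B; apply: filterS uB => n.
by rewrite ler_pdivrMr// scaling_gt0.
Qed.

Lemma near_ulim_set (A : forall n, set (X n)) u e : 0 < e ->
    ulim_set A (ulim_class u) ->
  \forall n \near ultra_sets w, tnbhd (e * d n) (A n) (u n).
Proof.
move=> e0 [a Aa ua]; have : mdist (ulim_class u) (ulim_class a) < e.
  by rewrite ua mdistxx.
move/near_ulim_mdist_lt => H; apply: filterS H => n uan.
by apply/tnbhdP; exists (a n).
Qed.

(** The hypothesis is asked for every [n], because [ulim_set] requires a representative that lies in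
    [A n] for every [n]. *)
Lemma ulim_set_near (A : forall n, set (X n)) u c :
    (forall n, tnbhd (c * d n) (A n) (u n)) ->
  exists2 z, @ulim_set _ _ _ x d A z & mdist (ulim_class u) z <= c.
Proof.
move=> H.
have aE n : {z : X n | A n z /\ mdist (u n) z < c * d n}.
  by apply: cid; have /tnbhdP[z Az uz] := H n; exists z.
have [B uB] := near_bounded_seq u.
have [|a aP] := @bounded_seq_exists (fun n => sval (aE n)) (B + c).
  apply: filterS uB => n xu; have [_] := svalP (aE n).
  by have := metric_triangle (x n) (u n) (sval (aE n)); rewrite mulrDl; lra.
exists (ulim_class a).
  by exists a => // n; rewrite aP; have [] := svalP (aE n).
apply: ulim_mdist_le; apply: nearW => n; rewrite aP ltW//.
by have [] := svalP (aE n).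
Qed.

Lemma ulim_set_of_near (A : forall n, set (X n)) u (c : nat -> R) :
    (forall n, tnbhd (c n * d n) (A n) (u n)) ->
    (forall e, 0 < e -> \forall n \near ultra_sets w, c n <= e) ->
  ulim_set A (ulim_class u).
Proof.
move=> H c0.
have aE n : {z : X n | A n z /\ mdist (u n) z < c n * d n}.
  by apply: cid; have /tnbhdP[z Az uz] := H n; exists z.
have ua e : 0 < e ->
    \forall n \near ultra_sets w, mdist (u n) (sval (aE n)) <= e * d n.
  move=> e0; apply: filterS (c0 e e0) => n cn; have [_ /ltW/le_trans] := svalP (aE n).
  by apply; rewrite ler_pM2r// scaling_gt0.
have [B uB] := near_bounded_seq u.
have [|a aP] := @bounded_seq_exists (fun n => sval (aE n)) (B + 1).
  apply: filterS2 uB (ua 1 ltr01) => n xu.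
  by have := metric_triangle (x n) (u n) (sval (aE n)); rewrite mulrDl; lra.
exists a; first by move=> n; rewrite aP; have [] := svalP (aE n).
apply/mdist_le0/ler_addgt0Pr => e e0; rewrite add0r.
by apply: ulim_mdist_le; apply: filterS (ua e e0) => n; rewrite aP.
Qed.

End ultralimits.

(** An ultrafilter refining the cofinite filter is non-principal, and every statement valid for all
    large [n] holds along it. Contradiction arguments use this to rescale by the size of their
    counterexamples. *)
Lemma scaling_exists (R : realType) (r : nat -> R) :
    (forall n, n.+1%:R <= r n) ->
  exists (w : nonprincipal_ultrafilter) (d : scaling R w),
    (forall n, d n = r n) /\ \oo `<=` ultra_sets w.
Proof.
move=> rn; have [G [GU ooG]] := ultraFilterLemma (eventually_filter).
have np n : G <> principal_filter n.
  move=> E; have : G [set m | (n < m)%N] by apply: ooG; exists n.+1.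
  by rewrite E /principal_filter/globally/= => /(_ n erefl); rewrite ltnn.
pose w := NonprincipalUltrafilter GU np.
have r0 n : 0 < r n by apply: lt_le_trans (rn n); rewrite ltr0n.
have roo : r n @[n --> ultra_sets w] --> +oo.
  apply/cvgryPge => A; apply: ooG; apply: filterS (nbhs_infty_ger A) => n An.
  by rewrite (le_trans An)// (le_trans _ (rn n))// ler_nat.
by exists w, (Scaling r0 roo).
Qed.

(** * Coarse consequences in the space itself *)

Lemma connected_lipschitz_image (R : realType) (U T : metricType R) (f : U -> T)
    (K : R) (E : set U) :
    (forall x y, mdist (f x) (f y) <= K * mdist x y) -> connected E ->
  connected (f @` E).
Proof.
move=> fK cE; apply: connected_continuous_connected => //.
apply: continuous_subspaceT => x; apply/metricType_numDomainType.cvgrPdist_lt => e e0.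
have K0 : 0 < `|K| + 1 by rewrite ltr_wpDl.
apply/metricType_numDomainType.nbhs_mdistP; exists (e / (`|K| + 1)) => /=.
  by rewrite divr_gt0.
move=> y /=; rewrite ltr_pdivlMr// => xy; apply: le_lt_trans (fK _ _) _.
apply: le_lt_trans xy; rewrite mulrC ler_wpM2l ?mdist_ge0//.
by rewrite (le_trans (ler_norm K))// lerDl.
Qed.

Lemma connected_lipschitz_path (R : realType) (T : metricType R) (f : R -> T)
    (K a b : R) :
    (forall s t, mdist (f s) (f t) <= K * `|s - t|) -> connected (f @` `[a, b]).
Proof.
move=> fK; apply: (@connected_lipschitz_image R R^o T f K).
  by move=> s t; apply: le_trans (fK s t) _; rewrite distrC.
exact: segment_connected.
Qed.

(** The space is the union of the complements of [a] and of [b], which share [c]. *)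
Lemma connectedT_of_no_cut_point (U : topologicalType) (a b c : U) :
    a <> c -> b <> c -> a <> b -> (forall p : U, connected (~` [set p])) ->
  connected [set: U].
Proof.
move=> ac bc ab cU; have <- : ~` [set a] `|` ~` [set b] = [set: U].
  apply/seteqP; split=> // z _; have [->|/eqP za] := eqVneq z a; last by left.
  by right.
by apply: connectedU => //; exists c; split=> /= E; [apply: ac|apply: bc].
Qed.

(** * Bilipschitz lines close to a piece *)

Section bilipschitz_line.
Context {R : realType} {T : metricType R} {Pc : set (set T)}.
Hypothesis Ttg : tree_graded Pc.

(* Otherwise the two halves of the line must both leave the basin of
   [f 0] through its exit point [e], contradicting injectivity. *)
Lemma bilipschitz_line_center (f : R -> T) (N : set T) (L a : R) :
    1 <= L -> 0 < a -> Pc N ->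
    (forall s t, L^-1 * `|s - t| <= mdist (f s) (f t) <= L * `|s - t|) ->
    (forall s, `|s| <= a -> exists2 m, N m & mdist (f s) m <= a / (4 * L)) ->
  N (f 0).
Proof.
move=> L1 a0 PN fL fN; apply: contrapT => nN0.
have L0 : 0 < L by exact: lt_le_trans L1.
have N0 : N !=set0 by have [|m Nm _] := fN 0; [rewrite normr0 ltW|exists m].
have [e Be] := basin_exists Ttg PN N0 nN0; have [_ Ne _] := Be.
have basin_near s : `|s| <= a -> basin N e (f s) -> mdist (f s) e <= a / (4 * L).
  move=> /fN[m Nm fm] [_ _ /(_ _ Nm) E]; have := mdist_ge0 e m; lra.
(* A half avoiding [e] stays in the basin of [e]. Then [f 0] and [f s] are both within [a / (4 * L)]
   of [e], whereas their distance is at least [a / L]. *)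
have half s l r : l <= 0 <= r -> `|s| = a -> l <= s <= r ->
    exists2 t, l <= t <= r & f t = e.
  move=> /andP[l0 r0] sa /andP[ls sr]; apply: contrapT => noe.
  have fE t : l <= t <= r -> (f @` `[l, r]) (f t).
    by move=> lr; exists t => //=; rewrite in_itv.
  have cE : connected (f @` `[l, r]).
    by apply: (@connected_lipschitz_path _ _ _ L) => t t'; have /andP[] := fL t t'.
  have nE : ~ (f @` `[l, r]) e.
    by move=> [t /=]; rewrite in_itv => lr ft; apply: noe; exists t.
  have Bs : basin N e (f s).
    apply: (connected_basin Ttg PN cE nE (fE 0 _) Be); first by rewrite l0 r0.
    by apply: fE; rewrite ls sr.
  have := basin_near s _ Bs; rewrite sa lexx => /(_ isT) se.
  have := basin_near 0 _ Be; rewrite normr0 ltW// => /(_ isT) oe.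
  have /andP[+ _] := fL s 0; rewrite subr0 sa.
  have := metric_triangle (f s) e (f 0); rewrite (metric_sym e).
  have aL : 0 < L^-1 * a by rewrite mulr_gt0// invr_gt0.
  have E4 : a / (4 * L) = L^-1 * a / 4.
    by rewrite invfM mulrCA mulrC [L^-1 * a]mulrC.
  by move: se oe; rewrite E4; lra.
have [|||t /andP[t0 _] ft] := half a 0 a; [lra|exact: gtr0_norm|lra|].
have [|||t' /andP[_ t'0] ft'] := half (- a) (- a) 0; [lra| |lra|].
  by rewrite normrN gtr0_norm.
(* Both halves pass through [e], so injectivity forces [t = t' = 0], and [f 0 = e] lies in [N]. *)
have /andP[+ _] := fL t t'; rewrite ft ft' mdistxx pmulr_rle0 ?invr_gt0//.
rewrite normr_le0 subr_eq0 => /eqP tt'.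
have tE : t = 0 by apply/eqP; rewrite eq_le t0 tt' t'0.
by apply: nN0; rewrite -tE ft.
Qed.

End bilipschitz_line.

(** * Coarse overlaps of two members of the collection *)

Section coarse_pieces.
Context {R : realType} {Y : metricType R} {P : set (set Y)}.
Hypothesis Yatg : asymptotically_tree_graded P.
Implicit Types (A : set Y) (x y z : Y).

Lemma cone_tree_graded w (x : nat -> Y) (d : scaling R w) :
  tree_graded (cone_pieces x d P).
Proof. by have [+ _] := Yatg; apply. Qed.

(** The coarse form of the fact that distinct pieces of a cone share at most one point.
    Counterexamples with [delta] tending to 0 and [D] to infinity, rescaled by [mdist x y], give two
    limit pieces sharing two distinct points; they coincide, so the limit of the points [z] lies in
    both. *)
Lemma coarse_piece_overlap (eps K : R) : 0 < eps ->
  exists delta D : R, [/\ 0 < delta, 0 < D & forall A A' x y, P A -> P A' ->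
    D <= mdist x y ->
    tnbhd (delta * mdist x y) A x -> tnbhd (delta * mdist x y) A y ->
    tnbhd (delta * mdist x y) A' x -> tnbhd (delta * mdist x y) A' y ->
    forall z, A' z -> mdist x z <= K * mdist x y ->
    tnbhd (eps * mdist x y) A z].
Proof.
move=> eps0; apply: contrapT => H.
have /choice[t tP] : forall n, exists t : set Y * set Y * (Y * Y * Y),
    let: (A, A', (x, y, z)) := t in let r := mdist x y in
    let c := n.+1%:R^-1 * r in
    [/\ P A /\ P A', n.+1%:R <= r, tnbhd c A x /\ tnbhd c A y,
        tnbhd c A' x /\ tnbhd c A' y &
        [/\ A' z, mdist x z <= K * r & ~ tnbhd (eps * r) A z]].
  move=> n; apply: contrapT => nbad; apply: H.
  exists n.+1%:R^-1, n.+1%:R; split=> // A A' x y PA PA' xy Ax Ay A'x A'y z A'z xz.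
  by apply: contrapT => Az; apply: nbad; exists (A, A', (x, y, z)).
pose A n := (t n).1.1; pose A' n := (t n).1.2.
pose x n := (t n).2.1.1; pose y n := (t n).2.1.2.
pose z n := (t n).2.2; pose r n := mdist (x n) (y n).
have bad n : let c := n.+1%:R^-1 * r n in
    [/\ P (A n) /\ P (A' n), n.+1%:R <= r n, tnbhd c (A n) (x n) /\ tnbhd c (A n) (y n),
        tnbhd c (A' n) (x n) /\ tnbhd c (A' n) (y n) &
        [/\ A' n (z n), mdist (x n) (z n) <= K * r n &
            ~ tnbhd (eps * r n) (A n) (z n)]].
  rewrite /r /A /A' /x /y /z; by case: (t n) (tP n) => -[B B'] [[p q] s].
have [w [d [dE oow]]] := scaling_exists (r := r) (fun n => let: And5 _ h _ _ _ := bad n in h).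
have c0 (e : R) : 0 < e -> \forall n \near ultra_sets w, n.+1%:R^-1 <= e.
  move=> e0; apply: oow; near=> n.
  have en : e^-1 <= n%:R by near: n; exact: nbhs_infty_ger.
  rewrite invf_ple ?posrE ?ltr0n//.
  by rewrite (le_trans en)// ler_nat.
have mk (s : nat -> Y) c : (forall n, mdist (x n) (s n) <= c * r n) ->
    exists u : @bounded_seq _ w (fun=> Y) x d, bseq_val u = s.
  move=> H'; apply: (@bounded_seq_exists _ _ _ _ _ _ c).
  by apply: nearW => n; rewrite dE.
have [|u uE] := mk x 0; first by move=> n; rewrite mdistxx mul0r.
have [|v vE] := mk y 1; first by move=> n; rewrite mul1r.
have [|k kE] := mk z K; first by move=> n; have [_ _ _ _ []] := bad n.
pose lim B : set (Cone x d) := @ulim_set R w (fun=> Y) x d B.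
have near0 (B : nat -> set Y) (q : bounded_seq x d) :
    (forall n, tnbhd (n.+1%:R^-1 * r n) (B n) (q n)) ->
    lim B (ulim_class q).
  by move=> Bq; apply: (@ulim_set_of_near _ _ _ _ _ _ _ (fun n => n.+1%:R^-1)) => // n; rewrite dE.
have Au : lim A (ulim_class u).
  by apply: near0 => n; rewrite uE; have [_ _ []] := bad n.
have Av : lim A (ulim_class v).
  by apply: near0 => n; rewrite vE; have [_ _ []] := bad n.
have A'u : lim A' (ulim_class u).
  by apply: near0 => n; rewrite uE; have [_ _ _ []] := bad n.
have A'v : lim A' (ulim_class v).
  by apply: near0 => n; rewrite vE; have [_ _ _ []] := bad n.
have uv : ulim_class u <> ulim_class v.
  move=> E; have : 1 <= mdist (ulim_class u) (ulim_class v).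
    by apply: ulim_mdist_ge; apply: nearW => n; rewrite uE vE mul1r dE.
  by rewrite E mdistxx ler10.
have EA : lim A = lim A'.
  apply: (piece_eq (cone_tree_graded x d) _ _ Au A'u Av A'v uv).
    by exists A; [move=> n; have [[]] := bad n|split=> //; exists (ulim_class u)].
  by exists A'; [move=> n; have [[]] := bad n|split=> //; exists (ulim_class u)].
have Ak : lim A (ulim_class k).
  rewrite EA; exists k => // n; rewrite kE.
  by have [_ _ _ _ []] := bad n.
have [n] := filter_ex (near_ulim_set eps0 Ak).
by rewrite dE kE; have [_ _ _ _ []] := bad n.
Unshelve. all: by end_near. Qed.

End coarse_pieces.

(** * The key fact: quasi-lines close to a piece *)

Definition quasi_line (R : realType) (Y : metricType R) (L C : R) (g : R -> Y) :=
  forall s t, L^-1 * `|s - t| - C <= mdist (g s) (g t) <= L * `|s - t| + C.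

Section quasi_lines_near_pieces.
Context {R : realType} {Y : metricType R} {P : set (set Y)}.
Hypothesis Yatg : asymptotically_tree_graded P.
Variables (L C : R).
Hypotheses (L_ge1 : 1 <= L) (C_ge0 : 0 <= C).

(** Counterexamples at scales [T] tending to infinity, based at the bad points [g t] and rescaled by
    [T], converge to an [L]-bilipschitz line close to a limit piece. Its center lies in that piece,
    contradicting the choice of the base points. *)
Lemma quasi_line_halving : exists2 D : R, 0 < D &
  forall A (g : R -> Y) T, P A -> quasi_line L C g -> D <= T ->
    (forall t, `|t| <= T -> tnbhd (T / (8 * L)) A (g t)) ->
    forall t, `|t| <= T / 2 -> tnbhd (T / 2 / (8 * L)) A (g t).
Proof.
have L0 : 0 < L by exact: lt_le_trans L_ge1.
have L8 : 0 < 2^-1 / (8 * L) by rewrite divr_gt0// mulr_gt0.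
apply: contrapT => H.
have /choice[k kP] : forall n, exists k : set Y * (R -> Y) * (R * R),
    let: (A, g, (T, t)) := k in
    [/\ P A, quasi_line L C g, n.+1%:R <= T,
      forall s, `|s| <= T -> tnbhd (T / (8 * L)) A (g s) &
      `|t| <= T / 2 /\ ~ tnbhd (T / 2 / (8 * L)) A (g t)].
  move=> n; apply: contrapT => nbad; apply: H; exists n.+1%:R => //.
  move=> A g T PA gq nT gT t tT; apply: contrapT => Agt; apply: nbad.
  by exists (A, g, (T, t)).
pose A n := (k n).1.1; pose g n := (k n).1.2.
pose T n := (k n).2.1; pose t0 n := (k n).2.2.
have bad n : [/\ P (A n), quasi_line L C (g n), n.+1%:R <= T n,
      forall s, `|s| <= T n -> tnbhd (T n / (8 * L)) (A n) (g n s) &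
      `|t0 n| <= T n / 2 /\ ~ tnbhd (T n / 2 / (8 * L)) (A n) (g n (t0 n))].
  by rewrite /A /g /T /t0; case: (k n) (kP n) => -[B h] [r s].
have T1 n : n.+1%:R <= T n by have [] := bad n.
have [w [d [dE _]]] := scaling_exists T1.
have T0 n : 0 < T n by apply: lt_le_trans (T1 n); rewrite ltr0n.
pose x n := g n (t0 n).
have gE n s s' : let D := mdist (g n (t0 n + s * T n)) (g n (t0 n + s' * T n)) in
    L^-1 * `|s - s'| * T n - C <= D <= L * `|s - s'| * T n + C.
  have [_ gq _ _ _] := bad n; have := gq (t0 n + s * T n) (t0 n + s' * T n).
  by rewrite opprD addrACA subrr add0r -mulrBl normrM (gtr0_norm (T0 n)) !mulrA.
have /choice[u uE] : forall s, exists u : @bounded_seq _ w (fun=> Y) x d,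
    bseq_val u = fun n => g n (t0 n + s * T n).
  move=> s; apply: (@bounded_seq_exists _ _ _ _ _ _ (L * `|s| + C)).
  apply: nearW => n; rewrite dE; have /andP[_] := gE n 0 s.
  rewrite mul0r addr0 sub0r normrN => xs; apply: (le_trans xs).
  rewrite mulrDl lerD2l ler_peMr// (le_trans _ (T1 n))// ler1n.
  by [].
pose f s : Cone x d := ulim_class (u s).
pose N : set (Cone x d) := @ulim_set R w (fun=> Y) x d A.
(* The half-width 1/2 comes from the bound [T / 2] on the base parameter: [t0 n + s * T n] stays
   within [T n] of 0. *)
have fN s : `|s| <= 2^-1 -> exists2 m, N m & mdist (f s) m <= 2^-1 / (4 * L).
  move=> s2; apply: ulim_set_near => n; rewrite uE dE.
  have [_ _ _ gN [tT _]] := bad n.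
  have -> : 2^-1 / (4 * L) * T n = T n / (8 * L) by field; rewrite gt_eqF.
  apply: gN; apply: le_trans (ler_normD _ _) _.
  rewrite normrM (gtr0_norm (T0 n)).
  have : `|s| * T n <= 2^-1 * T n by rewrite ler_pM2r.
  by lra.
have PN : cone_pieces x d P N.
  have [|m Nm _] := fN 0; first by rewrite normr0.
  by exists A; [move=> n; have [] := bad n|split=> //; exists m].
have fL s t : L^-1 * `|s - t| <= mdist (f s) (f t) <= L * `|s - t|.
  apply/andP; split; apply/ler_addgt0Pr => e e0; last first.
    apply: ulim_mdist_le; apply: filterS (@near_scaling_small _ w d C e e0) => n.
    rewrite !uE !dE mulrDl; have /andP[_] := gE n s t; lra.
  rewrite -lerBlDr; apply: ulim_mdist_ge.
  apply: filterS (@near_scaling_small _ w d C e e0) => n.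
  rewrite !uE !dE mulrBl; have /andP[+ _] := gE n s t; lra.
have h0 : (0 : R) < 2^-1 by [].
have Nf0 := bilipschitz_line_center (cone_tree_graded Yatg x d) L_ge1 h0 PN fL fN.
have [n] := filter_ex (near_ulim_set L8 Nf0).
rewrite uE dE mul0r addr0.
have -> : 2^-1 / (8 * L) * T n = T n / 2 / (8 * L) by field; rewrite gt_eqF.
by have [_ _ _ _ []] := bad n.
Qed.

(** Halve [T] until it is at most [D]; the bound [D / (8 * L)] reached then depends neither on [A]
    nor on the initial [T]. *)
Lemma quasi_line_near_piece : exists M : R,
  forall A (g : R -> Y) T, P A -> quasi_line L C g -> 0 <= T ->
    (forall t, `|t| <= T -> tnbhd (T / (8 * L)) A (g t)) -> tnbhd M A (g 0).
Proof.
have [D D0 half] := quasi_line_halving; exists (D / (8 * L)) => A g T PA gq.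
have L0 : 0 < L by exact: lt_le_trans L_ge1.
have [n] : exists n, T <= D * 2 ^+ n.
  have := nbhs_infty_ger (T / D); case=> n _ /(_ n (leqnn n)) /= Tn; exists n.
  rewrite -ler_pdivrMl// mulrC (le_trans Tn)// -natrX ler_nat.
  exact/ltnW/ltn_expl.
elim: n T => [|n IH] T Tn T0 gT.
  apply: tnbhdS (gT 0 _); last by rewrite normr0.
  by rewrite ler_pM2r ?invr_gt0 ?mulr_gt0//; rewrite expr0 mulr1 in Tn.
have [TD|/ltW DT] := leP T D.
  apply: tnbhdS (gT 0 _); last by rewrite normr0.
  by rewrite ler_pM2r ?invr_gt0 ?mulr_gt0.
apply: (IH (T / 2)); first by rewrite ler_pdivrMr// -mulrA -exprSr.
  by rewrite divr_ge0.
exact: half.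
Qed.

End quasi_lines_near_pieces.

(** * Images of spaces having a cone without cut-points *)

Section unconstricted_near_piece.
Context {R : realType} {Y : metricType R} {P : set (set Y)}.
Hypothesis Yatg : asymptotically_tree_graded P.

(** The map [q] induces a bilipschitz embedding of the cone of [B] in a cone of [Y]. Its image has
    no cut-points, so it lies in one limit piece. The radius [r] is one of the scaling constants
    [d n], and [A] is the corresponding member of a sequence defining that piece. *)
Lemma no_cut_point_near_piece (B : metricType R) (w : nonprincipal_ultrafilter)
    (d : scaling R w) (b : B) (q : B -> Y) (g : R -> B) (L C L' C' : R) :
    1 <= L -> 1 <= L' ->
    ~ has_cut_point (@ultralimit R w (fun=> B) (fun=> b) d) ->
    qi_embedding L C q -> quasi_line L' C' g ->
  forall eps K D : R, 0 < eps -> exists r A, [/\ D <= r, P A &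
    forall z, mdist b z <= K * r -> tnbhd (eps * r) A (q z)].
Proof.
move=> L1 L'1 ncp qq gq eps K D eps0.
have L0 : 0 < L by exact: lt_le_trans L1.
have L'0 : 0 < L' by exact: lt_le_trans L'1.
have iL'0 : 0 < L'^-1 by rewrite invr_gt0.
pose U : metricType R := @ultralimit R w (fun=> B) (fun=> b) d.
pose y (_ : nat) := q b.
have d0 n : 0 < d n := scaling_gt0 d n.
have mkU (s : nat -> B) c :
    (\forall n \near ultra_sets w, mdist b (s n) <= c * d n) ->
    exists u : @bounded_seq _ w (fun=> B) (fun=> b) d, bseq_val u = s.
  exact: bounded_seq_exists.
have gb s : \forall n \near ultra_sets w,
    mdist b (g (s * d n)) <= (L' * `|s| + 1) * d n.
  have sm := @near_scaling_small _ w d (mdist b (g 0) + C') 1 ltr01.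
  apply: filterS sm => n; have /andP[_] := gq 0 (s * d n).
  rewrite sub0r normrN normrM (gtr0_norm (d0 n)) mulrDl -mulrA.
  by have := metric_triangle b (g 0) (g (s * d n)); lra.
have [c0 oE] : exists u : @bounded_seq _ w (fun=> B) (fun=> b) d, bseq_val u = fun=> b.
  by apply: (mkU _ 0); apply: nearW => n; rewrite mdistxx mul0r.
(* The two ends of the quasi-line give points [p] and [m] distinct from each other and from the base
   point [c0]: two for the image to be non-trivial, a third for the connectedness of the whole
   cone. *)
have [p pE] := mkU _ _ (gb 1); have [m mE] := mkU _ _ (gb (-1)).
have neq (u v : @bounded_seq _ w (fun=> B) (fun=> b) d) (c : R) : 0 < c ->
    (\forall n \near ultra_sets w, c * d n <= mdist (u n) (v n)) ->
    ulim_class u <> ulim_class v :> U.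
  move=> cgt0 /ulim_mdist_ge cuv uv; move: cuv; rewrite uv mdistxx; lra.
have og s : `|s| = 1 -> \forall n \near ultra_sets w,
    L'^-1 / 2 * d n <= mdist (g (s * d n)) b.
  move=> s1; have e0 : 0 < L'^-1 / 2 by rewrite divr_gt0.
  have sm := @near_scaling_small _ w d (mdist b (g 0) + C') _ e0.
  apply: filterS sm => n; have /andP[+ _] := gq (s * d n) 0.
  rewrite subr0 normrM (gtr0_norm (d0 n)) s1 mul1r.
  by have := metric_triangle (g (s * d n)) b (g 0); lra.
have hL' : 0 < L'^-1 / 2 by rewrite divr_gt0.
have po : ulim_class p <> ulim_class c0 :> U.
  by apply: (neq _ _ _ hL'); rewrite pE oE; apply: og; rewrite normr1.
have mo : ulim_class m <> ulim_class c0 :> U.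
  by apply: (neq _ _ _ hL'); rewrite mE oE; apply: og; rewrite normrN1.
have pm : ulim_class p <> ulim_class m :> U.
  apply: (neq _ _ _ iL'0); rewrite pE mE.
  have sm := @near_scaling_small _ w d C' _ iL'0.
  apply: filterS sm => n; have /andP[+ _] := gq (1 * d n) (-1 * d n).
  by rewrite mul1r mulN1r opprK -mulr2n normrMn (gtr0_norm (d0 n)) mulr2n; lra.
have /choice[F FE] : forall u : @bounded_seq _ w (fun=> B) (fun=> b) d,
    exists v : @bounded_seq _ w (fun=> Y) y d, bseq_val v = fun n => q (u n).
  move=> u; have [c uc] := near_bounded_seq u.
  apply: (@bounded_seq_exists _ _ _ _ _ _ (L * c + 1)).
  apply: filterS2 uc (@near_scaling_small _ w d C 1 ltr01) => n bu Cd.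
  have /andP[_ qu] := qq b (u n); apply: (le_trans qu).
  by rewrite mulrDl -mulrA; apply: lerD => //; rewrite ler_pM2l.
have Fle u v : mdist (ulim_class (F u)) (ulim_class (F v)) <=
    L * mdist (ulim_class u) (ulim_class v).
  apply/ler_addgt0Pr => e e0; apply: ulim_mdist_le.
  pose c := mdist (ulim_class u) (ulim_class v) + e / 2 / L.
  have uvc : mdist (ulim_class u) (ulim_class v) < c.
    by rewrite ltrDl !divr_gt0.
  have e20 : 0 < e / 2 by rewrite divr_gt0.
  apply: filterS2 (near_ulim_mdist_lt uvc) (@near_scaling_small _ w d C _ e20).
  move=> n uvn Cd; rewrite !FE; have /andP[_ quv] := qq (u n) (v n).
  apply: (le_trans quv).
  have : L * mdist (u n) (v n) <= L * (c * d n) by rewrite ler_pM2l// ltW.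
  have -> : L * (c * d n) =
      L * mdist (ulim_class u) (ulim_class v) * d n + e / 2 * d n.
    by rewrite /c; field; rewrite gt_eqF.
  by rewrite mulrDl; lra.
have Fge u v : mdist (ulim_class u) (ulim_class v) <=
    L * mdist (ulim_class (F u)) (ulim_class (F v)).
  apply/ler_addgt0Pr => e e0; apply: ulim_mdist_le.
  pose c := mdist (ulim_class (F u)) (ulim_class (F v)) + e / 2 / L.
  have uvc : mdist (ulim_class (F u)) (ulim_class (F v)) < c.
    by rewrite ltrDl !divr_gt0.
  have e20 : 0 < e / 2 by rewrite divr_gt0.
  apply: filterS2 (near_ulim_mdist_lt uvc)
    (@near_scaling_small _ w d (L * C) _ e20).
  move=> n; rewrite !FE => uvn Cd; have /andP[quv _] := qq (u n) (v n).
  have : L * (L^-1 * mdist (u n) (v n) - C) <= L * (c * d n).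
    by rewrite ler_pM2l// (le_trans quv)// ltW.
  rewrite mulrBr mulrA divff ?gt_eqF// mul1r.
  have -> : L * (c * d n) =
      L * mdist (ulim_class (F u)) (ulim_class (F v)) * d n + e / 2 * d n.
    by rewrite /c; field; rewrite gt_eqF.
  by rewrite mulrDl; lra.
have /choice[h hE] : forall z : U, exists u, z = ulim_class u.
  exact: ulim_classP.
pose f (z : U) : Cone y d := ulim_class (F (h z)).
have fE u : f (ulim_class u) = ulim_class (F u).
  by apply/mdist_le0; rewrite (le_trans (Fle _ _))// -hE mdistxx mulr0.
have fle z z' : mdist (f z) (f z') <= L * mdist z z'.
  by rewrite {2}(hE z) {2}(hE z'); exact: Fle.
have fI z z' : f z = f z' -> z = z'.
  move=> fzz'; apply/mdist_le0; rewrite (hE z) (hE z').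
  by rewrite (le_trans (Fge _ _))// -[X in mdist X]/(f z) fzz' mdistxx mulr0.
have cU (z : U) : connected (~` [set z]).
  by apply: contrapT => nc; apply: ncp; right; exists z.
(* Either [e] is the image of one point, whose complement is connected, or nothing is removed from
   the range. *)
have cR (e : Cone y d) : connected (range f `\ e).
  have [[z _ ze]|nre] := pselect (range f e).
    have <- : f @` (~` [set z]) = range f `\ e.
      apply/seteqP; split=> [_ [z' z'z <-]|_ [[z' _ <-] z'e]].
        by split; [exists z'|rewrite -ze => /fI].
      by exists z' => // zz'; apply: z'e; rewrite /= zz'.
    exact: connected_lipschitz_image fle (cU z).
  have -> : range f `\ e = range f.
    by apply/seteqP; split=> [_ []//|z rz]; split=> // ze; apply: nre; rewrite -ze.
  apply: connected_lipschitz_image fle _.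
  exact: connectedT_of_no_cut_point po mo pm cU.
have rf z : range f (f z) by exists z.
have [|N [A PA [-> _]] rN] := sub_piece_of_no_cut_point
  (cone_tree_graded Yatg y d) (rf (ulim_class p)) (rf (ulim_class m)) _ cR.
  by move=> /fI.
apply: contrapT => H.
(* Bad points [z n] at all scales beyond [D], with [b] as default at smaller ones. They define a
   point of the cone whose image would lie off the limit piece. *)
have /choice[z zP] : forall n, exists z, mdist b z <= `|K| * d n /\
    (D <= d n -> ~ tnbhd (eps * d n) (A n) (q z)).
  move=> n; have [Dn|/negP nDn] := boolP (D <= d n); last first.
    by exists b; split=> //; rewrite mdistxx mulr_ge0// ltW.
  apply: contrapT => nz; apply: H; exists (d n), (A n); split=> // z zK.
  apply: contrapT => nAz; apply: nz; exists z; split=> //.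
  by rewrite (le_trans zK)// ler_pM2r// ler_norm.
have [|u uE] := mkU z `|K|; first by apply: nearW => n; have [] := zP n.
have : @ulim_set R w (fun=> Y) y d A (f (ulim_class u)) by exact/rN/rf.
rewrite fE => /(near_ulim_set eps0) Az.
have [n [Dn]] := filter_ex (filterI (@near_scaling _ w d D) Az).
by rewrite /= FE uE; have [_] := zP n; apply.
Qed.

End unconstricted_near_piece.

(** * Spaces filled by quasi-lines, and their images *)

Lemma distortion_comp (R : realType) (L C L' C' d e f : R) :
    1 <= L -> 1 <= L' -> 0 <= C' ->
    L'^-1 * d - C' <= e <= L' * d + C' -> L^-1 * e - C <= f <= L * e + C ->
  (L * L')^-1 * d - (L * C' + C) <= f <= L * L' * d + (L * C' + C).
Proof.
move=> L1 L'1 C'0 /andP[e1 e2] /andP[f1 f2].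
have L0 : 0 < L by exact: lt_le_trans L1.
apply/andP; split.
  have : L^-1 * (L'^-1 * d - C') <= L^-1 * e by rewrite ler_pM2l ?invr_gt0.
  rewrite invfM mulrBr mulrA.
  have : L^-1 * C' <= L * C'.
    by rewrite ler_wpM2r// (le_trans _ L1)// invf_le1.
  by lra.
have : L * e <= L * (L' * d + C') by rewrite ler_pM2l.
by rewrite mulrDr mulrA; lra.
Qed.

(** A coarse version of the first condition of unconstrictedness that survives quasi-isometries and
    passes from the members of a network to the whole space. *)
Definition lined (R : realType) (X : metricType R) (L C c : R) :=
  forall x : X, exists2 g : R -> X, quasi_line L C g & mdist x (g 0) <= c.

Section qi_embedding_composition.
Context {R : realType} {X Y Z : metricType R}.
Variables (L C L' C' : R).
Hypotheses (L_ge1 : 1 <= L) (L'_ge1 : 1 <= L') (C'_ge0 : 0 <= C').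

Lemma qi_embedding_comp (p : X -> Y) (q : Y -> Z) :
    qi_embedding L' C' p -> qi_embedding L C q ->
  qi_embedding (L * L') (L * C' + C) (q \o p).
Proof. by move=> pq qq x x'; exact: distortion_comp (pq x x') (qq _ _). Qed.

Lemma quasi_line_comp (g : R -> Y) (q : Y -> Z) :
    quasi_line L' C' g -> qi_embedding L C q ->
  quasi_line (L * L') (L * C' + C) (q \o g).
Proof. by move=> gq qq s t; exact: distortion_comp (gq s t) (qq _ _). Qed.

End qi_embedding_composition.

Section lined_spaces_near_pieces.
Context {R : realType} {Y : metricType R} {P : set (set Y)}.
Hypothesis Yatg : asymptotically_tree_graded P.
Variables (L C L' C' c : R).
Hypotheses (L_ge1 : 1 <= L) (C_ge0 : 0 <= C).
Hypotheses (L'_ge1 : 1 <= L') (C'_ge0 : 0 <= C') (c_ge0 : 0 <= c).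

(** The key fact for [q] composed with a quasi-line near [z]; [theta] is the ratio
    [1 / (8 * (L * L'))] required there. Since [c + C' <= T], the ball of radius [(L' + 1) * T]
    contains the quasi-line up to parameter [T]. *)
Lemma lined_center_near_piece : exists M theta : R, [/\ 0 <= M, 0 < theta &
  forall (B : metricType R) (q : B -> Y) A (z : B) T,
    lined B L' C' c -> qi_embedding L C q -> P A -> c + C' <= T ->
    (forall z', mdist z z' <= (L' + 1) * T -> tnbhd (theta * T) A (q z')) ->
  tnbhd M A (q z)].
Proof.
have LL'1 : 1 <= L * L' by rewrite -[1]mulr1 ler_pM.
have LL'0 : 0 < L * L' by exact: lt_le_trans LL'1.
have C20 : 0 <= L * C' + C by rewrite addr_ge0// mulr_ge0// (le_trans _ L_ge1).
have [M0 M0P] := quasi_line_near_piece Yatg LL'1 C20.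
exists (`|M0| + (L * c + C)), (8 * (L * L'))^-1; split.
- by rewrite addr_ge0// addr_ge0// mulr_ge0// (le_trans _ L_ge1).
- by rewrite invr_gt0 mulr_gt0.
move=> B q A z T lB qq PA cT near; have [g gq zg] := lB z.
have T0 : 0 <= T by apply: le_trans cT; rewrite addr_ge0.
have : tnbhd M0 A (q (g 0)).
  apply: (M0P A (q \o g) T PA (quasi_line_comp L_ge1 L'_ge1 C'_ge0 gq qq) T0) => t tT.
  rewrite mulrC; apply: near; have /andP[_] := gq 0 t.
  have := metric_triangle z (g 0) (g t); rewrite sub0r normrN.
  have : L' * `|t| <= L' * T by rewrite ler_wpM2l// (le_trans _ L'_ge1).
  by rewrite mulrDl mul1r; lra.
move/(tnbhdS (ler_norm M0))/tnbhd_shift; apply; rewrite metric_sym.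
have /andP[_ /le_trans] := qq z (g 0); apply.
by rewrite lerD2r ler_wpM2l// (le_trans _ L_ge1).
Qed.

(** For fixed [z], take [p] very far from [z] with [q p] close to [A]. Seen at the scale of their
    distance, [q z] and [q p] are close to both [A] and [A'], so [A'] is close to [A] around [q z],
    and the key fact applies. The bound [M] depends neither on [m] nor on [m'], so it does not
    deteriorate along chains. *)
Lemma lined_near_overlapping_piece : exists2 M : R, 0 <= M &
  forall (B : metricType R) (q : B -> Y) A A' (m m' : R),
    lined B L' C' c -> qi_embedding L C q -> P A -> P A' ->
    (forall z, tnbhd m' A' (q z)) ->
    (forall D : R, exists z1 z2,
       [/\ tnbhd m A (q z1), tnbhd m A (q z2) & D < mdist z1 z2]) ->
  forall z, tnbhd M A (q z).
Proof.
have [M [theta [M0 theta0 near]]] := lined_center_near_piece.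
have L0 : 0 < L by exact: lt_le_trans L_ge1.
exists M => // B q A A' m m' lB qq PA PA' A'q Aq z.
pose K := L * (L' + 1) + 1.
have theta20 : 0 < theta / 2 by rewrite divr_gt0.
have [delta [D [delta0 D0 ov]]] := coarse_piece_overlap Yatg K theta20.
have [z0 [_ [Az0 _ _]]] := Aq 0.
have [m1 [m10 Az m_m1]] : exists m1, [/\ 0 <= m1, tnbhd m1 A (q z) & m <= m1].
  exists (`|m| + mdist (q z0) (q z)); split.
  - by rewrite addr_ge0// mdist_ge0.
  - by apply: tnbhd_shift (tnbhdS (ler_norm m) Az0) _.
  - by rewrite (le_trans (ler_norm m))// lerDl mdist_ge0.
have m'0 := normr_ge0 m'.
have m1d : 0 <= m1 / delta by rewrite divr_ge0// ltW.
have m'd : 0 <= `|m'| / delta by rewrite divr_ge0// ltW.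
have m't : 0 <= 2 / theta * `|m'| by rewrite mulr_ge0// divr_ge0// ltW.
(* A scale at which all additive constants are negligible, including [m1], which depends on [z]. *)
have [D1 [D1D D1m1 D1m' D1c [D1C D1t]]] : exists D1, [/\ D <= D1,
    m1 / delta <= D1, `|m'| / delta <= D1, c + C' <= D1 &
    C + `|m'| <= D1 /\ 2 / theta * `|m'| <= D1].
  exists (D + m1 / delta + `|m'| / delta + (c + C') + (C + `|m'|) +
    2 / theta * `|m'|).
  move: m1d m'd m't D0 C_ge0 C'_ge0 c_ge0 m'0.
  set a1 := m1 / delta; set a2 := _ / delta; set a3 := _ * `|m'|; set a4 := `|m'|.
  clear; move=> *; split; [lra|lra|lra|lra|split; lra].
(* Of two points more than twice this bound apart, one is that far from [z]. *)
have [p [Ap Dp]] : exists p, tnbhd m A (q p) /\ L * (D1 + C) <= mdist z p.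
  have [z1 [z2 [Az1 Az2 z12]]] := Aq (L * (D1 + C) + L * (D1 + C)).
  have [zz1|/ltW zz1] := leP (L * (D1 + C)) (mdist z z1); first by exists z1.
  exists z2; split=> //; have := metric_triangle z1 z z2.
  by rewrite (metric_sym z1 z); lra.
pose rho := mdist (q z) (q p).
have D1rho : D1 <= rho.
  have /andP[+ _] := qq z p; rewrite -/rho.
  have : L^-1 * (L * (D1 + C)) <= L^-1 * mdist z p by rewrite ler_pM2l ?invr_gt0.
  by rewrite mulrA mulVf ?gt_eqF// mul1r; lra.
have m1rho : m1 <= delta * rho by rewrite mulrC -ler_pdivrMr// (le_trans D1m1).
have m'rho : m' <= delta * rho.
  apply: le_trans (ler_norm _) _.
  by rewrite mulrC -ler_pdivrMr// (le_trans D1m').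
apply: (near B q A z rho) => //; first exact: le_trans D1rho.
move=> z' zz'; have /tnbhdP[a' A'a' qa'] := A'q z'.
have : tnbhd (theta / 2 * rho) A a'.
  apply: (ov A A' (q z) (q p)) => //; try exact: tnbhdS (A'q _).
  - exact: le_trans D1rho.
  - exact: tnbhdS Az.
  - by apply: tnbhdS Ap; exact: le_trans m1rho.
  - have /andP[_ ] := qq z z'; rewrite -/rho.
    have := metric_triangle (q z) (q z') a'.
    have : L * mdist z z' <= L * ((L' + 1) * rho) by rewrite ler_pM2l.
    have -> : K * rho = L * ((L' + 1) * rho) + rho by rewrite /K; ring.
    have := ler_norm m'; lra.
move/(tnbhd_shift (s := m') (y := q z')); rewrite metric_sym ltW// => /(_ isT).
apply: tnbhdS; have : `|m'| <= theta / 2 * rho.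
  by rewrite -ler_pdivrMl// invf_div (le_trans D1t).
by have := ler_norm m'; lra.
Qed.

(** One [A] works on an initial large ball by the absence of cut-points. On a ball of twice the
    radius, compare [A] with the member [A'] of [P] obtained at a larger scale: they overlap along
    two far apart points, so they are close there, and the key fact restores the same [M]. Doubling
    exhausts [B]. *)
Lemma lined_near_piece : exists2 M : R, 0 <= M &
  forall (B : metricType R) (q : B -> Y) (b : B) (w : nonprincipal_ultrafilter)
    (d : scaling R w),
    lined B L' C' c -> qi_embedding L C q ->
    ~ has_cut_point (@ultralimit R w (fun=> B) (fun=> b) d) ->
  exists2 A, P A & forall z, tnbhd M A (q z).
Proof.
have [M [theta [M0 theta0 near]]] := lined_center_near_piece.
have L0 : 0 < L by exact: lt_le_trans L_ge1.
have L'0 : 0 < L' by exact: lt_le_trans L'_ge1.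
exists M => // B q b w d lB qq ncp.
have [K KE] : exists K, K = L' + 1 by exists (L' + 1).
(* At radius [r], the two comparison points will be at a distance [rho] between [kappa * r] and
   [(L + 1) * r]. The upper bound dictates [eps], so that [eps * rho] is at most half of
   [theta * r]; the lower one dictates [KT], which restates a radius in terms of [rho]. *)
pose kappa := (4 * L * L' ^+ 2)^-1.
have kappa0 : 0 < kappa by rewrite invr_gt0 !mulr_gt0// exprn_gt0.
pose eps := theta / (2 * (L + 1)).
have eps0 : 0 < eps by rewrite divr_gt0// mulr_gt0// addr_gt0.
pose KT := (L * (K + 2) + 1) / kappa.
have [delta [D [delta0 D0 ov]]] := coarse_piece_overlap Yatg KT eps0.
have [g gq bg] := lB b.
(* The closeness proportional to [r] on the ball of radius [(K + 1) * r] improves to [M] on the ball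
   of radius [r], by the key fact at each of its points. *)
have good D1 : exists r A, [/\ D1 <= r, P A &
    forall z, mdist b z <= r -> tnbhd M A (q z)].
  have [r [A [Dr PA Ar]]] := no_cut_point_near_piece Yatg L_ge1 L'_ge1 ncp qq gq
    (K + 1) (Num.max D1 (c + C')) theta0.
  exists r, A; split=> //; first by apply: le_trans Dr; rewrite le_max lexx.
  move=> z bz; apply: (near B q A z r) => //.
    by apply: le_trans Dr; rewrite le_max lexx orbT.
  move=> z' zz'; apply: Ar; have := metric_triangle b z z'.
  by move: zz'; rewrite -KE mulrDl mul1r; lra.
have ki0 : 0 < kappa^-1 by rewrite invr_gt0.
have cC : 0 <= (c + C') / L by rewrite divr_ge0 ?addr_ge0// ltW.
have [D1 [D1_1 D1c D1k D1D [D1d D1C D1t]]] : exists D1, [/\ 1 <= D1,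
    2 * (c + C') <= D1, kappa^-1 * ((c + C') / L + C) <= D1,
    kappa^-1 * D <= D1 & [/\ kappa^-1 * (M / delta) <= D1, C + M <= D1 &
    2 / theta * M <= D1]].
  have h1 : 0 <= kappa^-1 * ((c + C') / L + C) by rewrite mulr_ge0 ?addr_ge0// ltW.
  have h2 : 0 <= kappa^-1 * D by rewrite mulr_ge0// ltW.
  have h3 : 0 <= kappa^-1 * (M / delta).
    by rewrite mulr_ge0// ?divr_ge0// ltW.
  have h4 : 0 <= 2 / theta * M by rewrite mulr_ge0// divr_ge0// ltW.
  move: h1 h2 h3 h4 C_ge0 C'_ge0 c_ge0 M0.
  set a1 := kappa^-1 * (_ + _); set a2 := kappa^-1 * D.
  set a3 := kappa^-1 * (_ / _); set a4 := _ * M.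
  clear; move=> *; exists (1 + 2 * (c + C') + a1 + a2 + a3 + (C + M) + a4).
  by split; [lra|lra|lra|lra|split; lra].
have [r0 [A [Dr0 PA Ar0]]] := good D1; exists A => //.
have step r : r0 <= r -> (forall z, mdist b z <= r -> tnbhd M A (q z)) ->
    forall z, mdist b z <= r *+ 2 -> tnbhd M A (q z).
  move=> r0r Ar z bz.
  have Dr : D1 <= r by exact: le_trans r0r.
  have r_gt0 : 0 < r by apply: lt_le_trans Dr; exact: lt_le_trans D1_1.
  have cr := le_trans D1c Dr; have Cr := le_trans D1C Dr.
  have [r' [A' [Dr' PA' Ar']]] := good ((K + 2) * r).
  have t0 : 0 <= r / (2 * L') by rewrite divr_ge0// ?mulr_ge0// ltW.
  (* The second comparison point: its parameter keeps it in the ball of radius [r], yet at a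
     distance from [b] comparable to [r]. *)
  pose p := g (r / (2 * L')).
  have bp : mdist b p <= r.
    have /andP[_] := gq 0 (r / (2 * L')); rewrite sub0r normrN ger0_norm//.
    have -> : L' * (r / (2 * L')) = r / 2 by field; rewrite gt_eqF.
    have := metric_triangle b (g 0) p; rewrite -/p; lra.
  pose rho := mdist (q b) (q p).
  have rho_ge : kappa * r <= rho.
    have /andP[+ _] := gq 0 (r / (2 * L')); rewrite sub0r normrN ger0_norm//.
    have -> : L'^-1 * (r / (2 * L')) = 2 * L * kappa * r.
      by rewrite /kappa; field; rewrite !gt_eqF.
    rewrite -/p => gp.
    have bp' : 2 * L * kappa * r - (c + C') <= mdist b p.
      by have := metric_triangle (g 0) b p; rewrite (metric_sym (g 0) b); lra.
    have /andP[+ _] := qq b p; rewrite -/rho.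
    have : L^-1 * (2 * L * kappa * r - (c + C')) <= L^-1 * mdist b p.
      by rewrite ler_pM2l ?invr_gt0.
    have -> : L^-1 * (2 * L * kappa * r - (c + C')) = 2 * (kappa * r) - (c + C') / L.
      by field; rewrite gt_eqF.
    have : (c + C') / L + C <= kappa * r.
      by rewrite -ler_pdivrMl// (le_trans D1k).
    by lra.
  have rho_le : rho <= (L + 1) * r.
    have /andP[_] := qq b p; rewrite -/rho.
    have : L * mdist b p <= L * r by rewrite ler_pM2l.
    by rewrite mulrDl mul1r; lra.
  have Drho : D <= rho.
    by apply: le_trans rho_ge; rewrite -ler_pdivrMl// (le_trans D1D).
  have Mrho : M <= delta * rho.
    rewrite mulrC -ler_pdivrMr//; apply: le_trans rho_ge.
    by rewrite -ler_pdivrMl// (le_trans D1d).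
  have in' z' : mdist b z' <= (K + 2) * r -> tnbhd M A' (q z').
    by move=> bz'; apply: Ar'; exact: le_trans Dr'.
  have K0 : 0 < K by rewrite KE addr_gt0.
  have b_r' s : 0 <= s -> s <= r -> s <= (K + 2) * r.
    by move=> s0 sr; apply: (le_trans sr); rewrite ler_peMl//; [exact: ltW|lra].
  apply: (near B q A z r) => //; first by move: cr; rewrite mulr_natl mulr2n; lra.
  move=> z' zz'.
  have bz' : mdist b z' <= (K + 2) * r.
    have := metric_triangle b z z'; move: bz zz'; rewrite -KE mulrDl mulr2n; lra.
  have /tnbhdP[a' A'a' qa'] := in' _ bz'.
  have : tnbhd (eps * rho) A a'.
    apply: (ov A A' (q b) (q p)) => //.
    - by apply: tnbhdS (Ar _ _) => //; rewrite mdistxx ltW.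
    - by apply: tnbhdS (Ar _ _).
    - by apply: tnbhdS (in' _ _) => //; rewrite mdistxx b_r'// ltW.
    - by apply: tnbhdS (in' _ _) => //; rewrite b_r'// mdist_ge0.
    - apply: (@le_trans _ _ ((L * (K + 2) + 1) * r)); last first.
        rewrite /KT -mulrA ler_pM2l; last by rewrite addr_gt0// mulr_gt0// addr_gt0.
        by rewrite -ler_pdivrMl// invrK.
      have /andP[_] := qq b z'; have := metric_triangle (q b) (q z') a'.
      have : L * mdist b z' <= L * ((K + 2) * r) by rewrite ler_pM2l.
      have -> : (L * (K + 2) + 1) * r = L * ((K + 2) * r) + r by ring.
      by lra.
  move/(tnbhd_shift (s := M) (y := q z')); rewrite metric_sym ltW// => /(_ isT).
  apply: tnbhdS.
  have : eps * rho <= eps * ((L + 1) * r) by rewrite ler_pM2l.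
  have -> : eps * ((L + 1) * r) = theta / 2 * r.
    by rewrite /eps; field; rewrite gt_eqF// addr_gt0.
  have : M <= theta / 2 * r.
    by rewrite -ler_pdivrMl ?divr_gt0// invf_div (le_trans D1t).
  by lra.
have r00 : 0 < r0 by apply: lt_le_trans Dr0; exact: lt_le_trans D1_1.
have all n : forall z, mdist b z <= r0 *+ (2 ^ n) -> tnbhd M A (q z).
  elim: n => [|n IH]; first by rewrite expn0 mulr1n.
  rewrite expnSr mulrnA; apply: step => //.
  by rewrite -mulr_natl ler_peMl ?ler1n ?expn_gt0 ?ltW.
move=> z; have := nbhs_infty_ger (mdist b z / r0) => -[n _ /(_ n (leqnn n))] /= zn.
apply: (all n); rewrite -mulr_natl -ler_pdivrMr// (le_trans zn)// ler_nat.
exact/ltnW/ltn_expl.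
Qed.

End lined_spaces_near_pieces.

(** * Induction on the order of thickness *)

Section thickness_induction.
Context {R : realType} {Y : metricType R} {P : set (set Y)}.
Hypothesis Yatg : asymptotically_tree_graded P.

Definition uniformly_lined (I : Type) (X : I -> metricType R) :=
  exists L C c : R, [/\ 1 <= L, 0 <= C, 0 <= c & forall i, lined (X i) L C c].

(** The point [x] rules out an empty space, from which no member of [P] could be produced. The bound
    [M] is common to the family. *)
Definition uniformly_near_pieces (I : Type) (X : I -> metricType R) :=
  forall L C : R, 1 <= L -> 0 <= C -> exists2 M : R, 0 <= M &
    forall i (x : X i) (q : X i -> Y), qi_embedding L C q ->
      exists2 A, P A & forall z, tnbhd M A (q z).

(** Let [s] choose, for each [y], a point whose image under [r] is within [C] of [y]. *)
Lemma quasi_inverse (B B' : metricType R) (L C : R) (r : B -> B') :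
    1 <= L -> 0 <= C -> quasi_isometry L C r ->
  exists s : B' -> B, qi_embedding L (3 * L * C) s /\
    forall x, mdist x (s (r x)) <= 2 * L * C.
Proof.
move=> L1 C0 [rq rs]; have L0 : 0 < L by exact: lt_le_trans L1.
have /choice[s sP] : forall y, exists x, mdist y (r x) <= C by [].
have up x x' : mdist x x' <= L * (mdist (r x) (r x') + C).
  have /andP[+ _] := rq x x'; rewrite lerBlDr.
  by rewrite ler_pdivrMl.
exists s; split=> [y y'|x]; last first.
  apply: (le_trans (up _ _)).
  have -> : 2 * L * C = L * (C + C) by ring.
  by rewrite ler_pM2l// lerD2r.
have sy := sP y; have sy' := sP y'.
apply/andP; split.
  have /andP[_] := rq (s y) (s y').
  have := metric_triangle y (r (s y)) y'.
  have := metric_triangle (r (s y)) (r (s y')) y'.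
  rewrite (metric_sym (r (s y')) y') => t1 t2 rss.
  have : mdist y y' <= L * (mdist (s y) (s y') + 3 * L * C).
    have : 3 * C <= L * (3 * L * C).
      have -> : L * (3 * L * C) = L ^+ 2 * (3 * C) by ring.
      by rewrite ler_peMl ?mulr_ge0// exprn_ege1.
    by rewrite mulrDr; lra.
  by rewrite -ler_pdivrMl// lerBlDr.
apply: (le_trans (up _ _)).
have -> : L * mdist y y' + 3 * L * C = L * (mdist y y' + 2 * C + C) by ring.
rewrite ler_pM2l// lerD2r.
have := metric_triangle (r (s y)) y (r (s y')).
have := metric_triangle y y' (r (s y')).
by rewrite (metric_sym (r (s y)) y); lra.
Qed.

(** Both properties are carried over from the strictly unconstricted model [B'] by the coarsely
    inverse maps [r] and [s]. *)
Lemma unconstricted_lined_near_pieces (I : Type) (B : I -> metricType R) :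
  uniformly_unconstricted B -> uniformly_lined B /\ uniformly_near_pieces B.
Proof.
move=> [B' [[c cP] ncp] [L0 [C0 [L01 C00 qi]]]].
have lB' i : lined (B' i) 1 0 `|c|.
  move=> b; have [g gg [t bt]] := cP i b; exists (fun s => g (t + s)).
    move=> s s'; rewrite gg// opprD addrACA subrr add0r.
    by rewrite invr1 !mul1r subr0 addr0 lexx.
  by rewrite addr0 (le_trans bt)// ler_norm.
have sE i : exists r (s : B' i -> B i), [/\ qi_embedding L0 C0 r,
    qi_embedding L0 (3 * L0 * C0) s & forall x, mdist x (s (r x)) <= 2 * L0 * C0].
  have [r rqi] := qi i; have [s [sq rs]] := quasi_inverse L01 C00 rqi.
  by exists r, s; case: rqi.
have L0_ge0 : 0 <= L0 by exact: le_trans L01.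
have LC0 : 0 <= 3 * L0 * C0 by rewrite !mulr_ge0.
have LC2 : 0 <= 2 * L0 * C0 by rewrite !mulr_ge0.
split.
  exists (L0 * 1), (L0 * 0 + 3 * L0 * C0), (2 * L0 * C0 + (L0 * `|c| + 3 * L0 * C0)).
  split.
  - by rewrite mulr1.
  - by rewrite mulr0 add0r.
  - by rewrite !addr_ge0// mulr_ge0.
  move=> i x; have [r [s [rq sq rs]]] := sE i.
  have [g gq rg] := lB' i (r x); exists (s \o g).
    exact: (quasi_line_comp L01 (lexx 1) (lexx 0) gq sq).
  have /andP[_] := sq (r x) (g 0); have := rs x.
  have := metric_triangle x (s (r x)) (s (g 0)).
  have : L0 * mdist (r x) (g 0) <= L0 * `|c| by rewrite ler_wpM2l.
  by rewrite /=; lra.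
move=> L C L1 C_ge0.
have LL : 1 <= L * L0 by rewrite -[1]mulr1 ler_pM.
have L_ge0 : 0 <= L by exact: le_trans L1.
have LC : 0 <= L * (3 * L0 * C0) + C by rewrite addr_ge0// mulr_ge0.
have [M M0 MP] := lined_near_piece Yatg LL LC (lexx 1) (lexx 0) (normr_ge0 c).
exists (M + (L * (2 * L0 * C0) + C)).
  by rewrite addr_ge0// addr_ge0// mulr_ge0.
move=> i x q qq; have [r [s [rq sq rs]]] := sE i.
(* A constant sequence of spaces is enough: the uniformity of [M] over the family comes from the key
   fact, not from the cones. *)
have [w [d wd]] := ncp (fun=> i).
have [A PA Aq] := MP _ (q \o s) (r x) w d (lB' i)
  (qi_embedding_comp L1 L01 LC0 sq qq) (wd (fun=> r x)).
exists A => // z; apply: tnbhd_shift (Aq (r z)) _ => /=.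
rewrite metric_sym; have /andP[_ /le_trans] := qq z (s (r z)); apply.
by rewrite lerD2r ler_wpM2l.
Qed.

Lemma set_val_surj (X : metricType R) (A : set X) a : A a ->
  exists a' : A, set_val a' = a.
Proof. by move=> Aa; exists (SigSub (mem_set Aa)). Qed.

(** The image of each member of the network is close to some set in [P]. Unbounded overlaps carry
    the set found for a first member along chains to all the others, and [tau]-neighborhoods of the
    members cover the space. *)
Lemma network_near_pieces (I : Type) (X : I -> metricType R) (tau : R)
    (N : forall i, set (set (X i))) :
    0 < tau -> (forall i, network tau (N i)) ->
    uniformly_lined (@union_members R I X N) ->
    uniformly_near_pieces (@union_members R I X N) ->
  uniformly_lined X /\ uniformly_near_pieces X.
Proof.
move=> tau0 net [L' [C' [c [L'1 C'0 c0 lN]]]] near.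
have netmem i (x : X i) : exists2 A, N i A & tnbhd tau A x.
  have [netU _] := net i; have : [set: X i] x by [].
  by rewrite netU => -[A NA Ax]; exists A.
split.
  exists L', C', (tau + c); split=> //; first by rewrite addr_ge0// ltW.
  move=> i x; have [A NA /tnbhdP[a Aa xa]] := netmem i x.
  have [a' a'E] := set_val_surj Aa.
  have [g gq ag] := lN (existT _ i (exist _ A NA)) a'.
  exists (fun s => set_val (g s)); first exact: gq.
  have := metric_triangle x a (set_val (g 0)).
  by move: ag; rewrite {1}/mdist /= /induced_mdist a'E; lra.
move=> L C L1 C0.
have L_ge0 : 0 <= L by exact: le_trans L1.
have [M1 M10 M1P] := near L C L1 C0.
have [M2 M20 M2P] := lined_near_overlapping_piece Yatg L1 C0 L'1 C'0 c0.
have LtC : 0 <= L * tau + C by rewrite addr_ge0// mulr_ge0// ltW.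
exists (M1 + M2 + (L * tau + C)); first by rewrite addr_ge0// addr_ge0.
move=> i x q qq.
have memP A a : N i A -> A a -> exists2 Q, P Q & forall b, A b -> tnbhd M1 Q (q b).
  move=> NA Aa; have [a' a'E] := set_val_surj Aa.
  have [|Q PQ Qq] := M1P (existT _ i (exist _ A NA)) a' (fun b => q (set_val b)).
    by move=> b b'; exact: qq.
  exists Q => // b Ab; have [b' <-] := set_val_surj Ab.
  exact: Qq.
have [A0 NA0 /tnbhdP[a0 A0a0 _]] := netmem i x.
have [Q PQ Q0] := memP A0 a0 NA0 A0a0; exists Q => //.
have allQ A : N i A -> forall a, A a -> tnbhd (M1 + M2) Q (q a).
  move=> NA; have [_ /(_ A0 A NA0 NA)[n [S [S0 Sn SN Sinf]]]] := net i.
  (* The first member is within [M1] of [Q] and each later one within [M2], whatever bound held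
     before it; [M1 + M2] covers both, independently of the length of the chain. *)
  suff H k : (k <= n)%N -> forall a, S k a -> tnbhd (M1 + M2) Q (q a).
    by rewrite -Sn; exact: H.
  elim: k => [|k IH] kn a.
    by rewrite S0 => /Q0; apply: tnbhdS; rewrite lerDl.
  move=> Sa; have [Q' PQ' Q'S] := memP _ _ (SN _ kn) Sa.
  have close y : (tnbhd tau (S k) `&` tnbhd tau (S k.+1)) y ->
      exists2 b, S k.+1 b &
        mdist y b < tau /\ tnbhd (M1 + M2 + (L * (tau + tau) + C)) Q (q b).
    move=> [/tnbhdP[b' Sb' yb'] /tnbhdP[b Sb yb]]; exists b => //; split=> //.
    apply: tnbhd_shift (IH (ltnW kn) _ Sb') _.
    have /andP[_ /le_trans] := qq b' b; apply.
    rewrite lerD2r ler_wpM2l//; have := metric_triangle b' y b.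
    by rewrite (metric_sym b' y); lra.
  have [a' <-] := set_val_surj Sa.
  apply: (@tnbhdS _ _ M2); first by rewrite lerDr.
  apply: (M2P _ (fun b : S k.+1 => q (set_val b)) Q Q'
    (M1 + M2 + (L * (tau + tau) + C)) M1) => //.
  - exact: (lN (existT _ i (exist _ (S k.+1) (SN _ kn)))).
  - by move=> b b'; exact: qq.
  - by move=> b; apply: Q'S; exact: set_valP.
  move=> D; have [y [z [yS zS yz]]] := Sinf k kn (D + (tau + tau)).
  have [b Sb [yb bQ]] := close y yS; have [e Se [ze eQ]] := close z zS.
  have [b' b'E] := set_val_surj Sb; have [e' e'E] := set_val_surj Se.
  exists b', e'; split; [by rewrite b'E|by rewrite e'E|].
  rewrite {1}/mdist /= /induced_mdist b'E e'E.
  have := metric_triangle y b z; have := metric_triangle b e z.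
  by rewrite (metric_sym e z); lra.
move=> z; have [A NA /tnbhdP[a Aa za]] := netmem i z.
apply: tnbhd_shift (allQ A NA a Aa) _.
have /andP[_ /le_trans] := qq a z; apply.
by rewrite lerD2r ler_wpM2l// metric_sym ltW.
Qed.

(** The two properties are proved together, as passing to a network uses quasi-lines in its members.
    The induction hypothesis is applied to the union of all the networks, which makes the constants
    uniform in [i]. *)
Lemma uniformly_thick_near_pieces n (I : Type) (X : I -> metricType R) :
  uniformly_thick n X -> uniformly_lined X /\ uniformly_near_pieces X.
Proof.
elim: n I X => [|n IH] I X; first exact: unconstricted_lined_near_pieces.
move=> [tau tau0 [N [netN /IH[lN nN]]]].
by apply: (network_near_pieces tau0) lN nN => i; have [] := netN i.
Qed.

End thickness_induction.

Theorem theorem7p8 (R : realType)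
    (I : Type) (X : I -> metricType R) (Y : metricType R) (P : set (set Y))
    (X_neq0 : forall i, [set: X i] !=set0)
    (X_thick : exists n, uniformly_thick n X)
    (Y_geodesic : geodesic_space Y)
    (Y_atg : asymptotically_tree_graded P)
    (L C : R) (L_ge1 : 1 <= L) (C_ge0 : 0 <= C) :
  exists M : R, forall (i : I) (q : X i -> Y), qi_embedding L C q ->
    exists2 A, P A & range q `<=` tnbhd M A.
Proof.
have [n Xn] := X_thick; have [_ near] := uniformly_thick_near_pieces Y_atg Xn.
have [M _ MP] := near L C L_ge1 C_ge0; exists M => i q qq.
have [x _] := X_neq0 i; have [A PA Aq] := MP i x q qq.
by exists A => // _ [z _ <-].
Qed.
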